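(* Let $1<r<\infty$ and let $s$ be defined by $\frac1s=\frac12+\frac1{\max\{r,2\}}$. Then $$B_{\ell_r}\cap\ell_s\subsetneq\mathrm{mon}\,H_\infty(B_{\ell_r}).$$
   Context: $B_{\ell_r}$ is the open unit ball of complex $\ell_r$, and $H_\infty(B_{\ell_r})$ is the space of bounded holomorphic (Fréchet differentiable) functions on $B_{\ell_r}$. For each such $f$ the monomial coefficients $c_\alpha(f)$, $\alpha\in\mathbb N_0^{(\mathbb N)}$ (finitely supported multi-indices), are the unique scalars with $f(z)=\sum_\alpha c_\alpha(f)z^\alpha$ for all finitely supported $z\in B_{\ell_r}$. The set of monomial convergence is $\mathrm{mon}\,H_\infty(B_{\ell_r})=\{z\in B_{\ell_r}:\sum_\alpha|c_\alpha(f)z^\alpha|<\infty\text{ for all }f\in H_\infty(B_{\ell_r})\}$. ($\subsetneq$ means proper inclusion.) *)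

(* Defs.v *)
From HB Require Import structures.
From mathcomp Require Import all_boot all_order all_algebra finmap.
From mathcomp Require Import complex.
From mathcomp Require Import all_classical all_reals all_analysis.
From mathcomp Require summability.

Set Implicit Arguments.
Unset Strict Implicit.
Unset Printing Implicit Defensive.

Import Order.TTheory GRing.Theory Num.Theory.
Import numFieldNormedType.Exports.

Local Open Scope classical_set_scope.
Local Open Scope ring_scope.

(* The complex numbers as a normed module over themselves; the norm `|z| is the
   modulus of z seen as an element of [R[i]]. *)
Notation Cplx R := (R[i]^o).

(* The modulus as an element of [R]. *)
Notation modulus := (@Normc.normc _).

Section EllPredicate.
Variables (R : realType) (p : R).

Definition ell_enorm (x : nat -> Cplx R) : \bar R :=
  ('N[counting]_p%:E[EFin \o (modulus \o x)])%E.

Definition ellp : {pred nat -> Cplx R} :=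
  mem [set x : nat -> Cplx R | (ell_enorm x < +oo)%E].

End EllPredicate.

(* The space of p-summable complex sequences as a normed module over the complex
   field; its norm takes its values in [R[i]], as for every normed module over
   [R[i]]. *)
Record ell (R : realType) (p : R) (p1 : 1 <= p) :=
  Ell { ell_val :> nat -> Cplx R ; ell_valP : ell_val \in ellp p }.

Section EllSpace.
Variables (R : realType) (p : R) (p1 : 1 <= p).

Local Notation ell := (ell p1).

HB.instance Definition _ := [isSub for @ell_val R p p1].
HB.instance Definition _ := [Choice of ell by <:].

Local Notation Nm := (@ell_enorm R p).

Let p1E : (1 <= p%:E)%E. Proof. by rewrite lee_fin. Qed.

Let p_gt0 : 0 < p. Proof. exact: lt_le_trans p1. Qed.

Lemma modulus_ge0 (z : R[i]) : 0 <= modulus z :> R.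
Proof. by case: z => a b; exact: sqrtr_ge0. Qed.

Let mnat (f : nat -> R) : measurable_fun [set: nat] f.
Proof. by []. Qed.

Let le_Lnorm (f g : nat -> R) : (forall k, 0 <= f k <= g k) ->
  ('N[counting]_p%:E[EFin \o f] <= 'N[counting]_p%:E[EFin \o g])%E.
Proof.
move=> fg; rewrite !Lnorm_counting//.
apply: gt0_ler_poweR.
- by rewrite invr_ge0 ltW.
- by rewrite in_itv/= leey andbT nneseries_ge0// => *; exact: poweR_ge0.
- by rewrite in_itv/= leey andbT nneseries_ge0// => *; exact: poweR_ge0.
apply: lee_nneseries => [*|k _]; first exact: poweR_ge0.
have /andP[f0 fg'] := fg k.
apply: gt0_ler_poweR; first by rewrite ltW.
- by rewrite in_itv/= lee_fin normr_ge0 leey.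
- by rewrite in_itv/= lee_fin normr_ge0 leey.
by rewrite /= !ger0_norm// (le_trans f0).
Qed.

Lemma ell_enorm_ge0 x : (0 <= Nm x)%E.
Proof. exact: Lnorm_ge0. Qed.

Lemma ell_enorm0 : Nm (fun=> 0) = 0%E.
Proof.
rewrite /ell_enorm (_ : EFin \o _ = cst 0%E); last first.
  by apply/funext => k /=; congr EFin; exact: Normc.normc0.
by rewrite Lnorm0// gt_eqF.
Qed.

Lemma ell_enormD x y : (Nm (fun k => x k + y k)%R <= Nm x + Nm y)%E.
Proof.
apply: (@le_trans _ _ ('N[counting]_p%:E[EFin \o
   ((modulus \o x) \+ (modulus \o y))%R])%E).
  by apply: le_Lnorm => k; rewrite modulus_ge0/=; exact: le_normcD.
exact: (@eminkowski _ _ _ counting _ _ p%:E (mnat _) (mnat _) p1E).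
Qed.

Lemma ell_enormZ (a : Cplx R) x :
  Nm (fun k => a * x k) = ((modulus a)%:E * Nm x)%E.
Proof.
rewrite /ell_enorm !Lnorm_counting//.
have E k : (`|(EFin \o (modulus \o (fun k => (a * x k)%R))) k| `^ p =
            (modulus a `^ p)%:E * (`|(EFin \o (modulus \o x)) k| `^ p))%E.
  rewrite /= Normc.normcM normrM (ger0_norm (modulus_ge0 a)).
  by rewrite powRM ?modulus_ge0// EFinM.
rewrite (eq_eseriesr (fun k _ => E k)) nneseriesZl; last first.
  by move=> *; exact: poweR_ge0.
rewrite poweRM ?lee_fin ?powR_ge0//; last first.
  by apply: nneseries_ge0 => *; exact: poweR_ge0.
by rewrite poweR_EFin -powRrM mulfV ?gt_eqF// powRr1// modulus_ge0.
Qed.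

Lemma ellp_submod_closed : submod_closed (ellp p).
Proof.
split; first by rewrite inE /=; have := ell_enorm0; rewrite /0 /= => ->.
move=> a x y; rewrite !inE => xp yp.
apply: le_lt_trans (ell_enormD (fun k => a * x k) y) _.
by rewrite ell_enormZ lte_add_pinfty// lte_mul_pinfty// lee_fin modulus_ge0.
Qed.

HB.instance Definition _ := GRing.isSubmodClosed.Build _ _ (ellp p)
  ellp_submod_closed.

HB.instance Definition _ := [SubChoice_isSubLmodule of ell by <:].

Definition ell_norm (x : ell) : R := fine (Nm x).

Lemma ell_normE (x : ell) : (ell_norm x)%:E = Nm x.
Proof.
rewrite /ell_norm fineK// ge0_fin_numE ?ell_enorm_ge0//.
by have := ell_valP x; rewrite inE.
Qed.

Let ler_ell_normD (x y : ell) :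
  ((ell_norm (x + y))%:C)%C <= ((ell_norm x)%:C)%C + ((ell_norm y)%:C)%C.
Proof.
by rewrite -rmorphD/= lecR -lee_fin EFinD !ell_normE; exact: ell_enormD.
Qed.

Let ell_normZ (a : R[i]) (x : ell) :
  ((ell_norm (a *: x))%:C)%C = `|a| * ((ell_norm x)%:C)%C.
Proof.
have -> : ell_norm (a *: x) = modulus a * ell_norm x.
  by apply: EFin_inj; rewrite EFinM !ell_normE; exact: ell_enormZ.
by rewrite rmorphM/=; case: a.
Qed.

Let ell_norm_eq0 (x : ell) : ((ell_norm x)%:C)%C = 0 -> x = 0.
Proof.
move=> xC0; have x0 : ell_norm x = 0 by exact: (congr1 (@complex.Re R) xC0).
apply: val_inj; apply: funext => k; apply: Normc.eq0_normc.
have := ell_normE x; rewrite x0 /ell_enorm Lnorm_counting// => /esym.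
move=> /poweR_eq0_eq0 s0.
have {}s0 : (\sum_(j <oo) `|(EFin \o (modulus \o x)) j| `^ p = 0)%E.
  by apply: s0; apply: nneseries_ge0 => *; exact: poweR_ge0.
have : (`|(EFin \o (modulus \o x)) k| `^ p <= 0)%E.
  rewrite -s0 (nneseriesD1 (n := k))//; last by move=> *; exact: poweR_ge0.
  by rewrite leeDl// nneseries_ge0// => *; exact: poweR_ge0.
rewrite /= lee_fin => h.
have /eqP : `|modulus (x k)| `^ p = 0 by apply/eqP; rewrite eq_le h powR_ge0.
by rewrite powR_eq0 normr_eq0 => /andP[/eqP].
Qed.

HB.instance Definition _ := Lmodule_isNormed.Build R[i] ell
  ler_ell_normD ell_normZ ell_norm_eq0.

End EllSpace.

Lemma ellpE (R : realType) (p : R) (x : nat -> Cplx R) : 0 < p ->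
  x \in ellp p <-> (\sum_(k <oo) (modulus (x k) `^ p)%:E < +oo)%E.
Proof.
move=> p0; rewrite inE /= /ell_enorm Lnorm_counting//.
rewrite (_ : (\sum_(k <oo) _ = \sum_(k <oo) (modulus (x k) `^ p)%:E)%E).
  by split; [apply: lty_poweRy; rewrite gt_eqF ?invr_gt0 | exact: poweR_lty].
by apply: eq_eseriesr => k _ /=; rewrite ger0_norm// modulus_ge0.
Qed.

Section MonomialConvergence.
Variables (R : realType) (r : R) (r1 : 1 <= r).
Local Notation ell := (ell r1).

Definition unit_ball : set ell := ball (0 : ell) 1.

Lemma unit_ballE (z : ell) : unit_ball z <-> ell_norm z < 1.
Proof.
rewrite /unit_ball -ball_normE /= sub0r normrN.
change (((ell_norm z)%:C%C < (1 : R)%:C%C) <-> ell_norm z < 1).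
by rewrite ltcR.
Qed.

(* Bounded holomorphic functions on the unit ball, represented by total functions
   whose values outside the ball are irrelevant. [differentiable] is Frechet
   differentiability of maps between normed modules over [R[i]], i.e. with a
   continuous complex-linear differential. *)
Definition Hoo : set (ell -> Cplx R) :=
  [set f : ell -> Cplx R | (forall z, unit_ball z -> differentiable f z) /\
           exists M : R, forall z, unit_ball z -> modulus (f z) <= M].

(* Finitely supported multi-indices. *)
Definition multi_index := {fsfun nat -> nat with 0%N}.

Definition monomial (a : multi_index) (z : nat -> Cplx R) : Cplx R :=
  \prod_(k <- finsupp a) z k ^+ a k.

(* The sum over all multi-indices is the unordered one: the limit of the partial
   sums along the finite sets of multi-indices directed by inclusion. *)
Definition monomial_expansion (f : ell -> Cplx R) (c : multi_index -> Cplx R) :=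
  forall z, unit_ball z -> finite_set [set k | z k != 0] ->
    summability.partial_sum (fun a => c a * monomial a z)
      @ summability.totally --> f z.

(* The family of coefficients c(f), by definite description: for f in [Hoo] there
   is exactly one family satisfying [monomial_expansion f]. *)
Definition monomial_coef (f : ell -> Cplx R) : multi_index -> Cplx R :=
  [get c | monomial_expansion f c].

Definition monHoo : set ell :=
  [set z | unit_ball z /\ forall f, Hoo f ->
    (\esum_(a in [set: multi_index])
       (modulus (monomial_coef f a * monomial a z))%:E < +oo)%E].

End MonomialConvergence.

Arguments unit_ball {R r} r1 z.
Arguments Hoo {R r} r1 f.
Arguments monHoo {R r} r1 z.

(* Main.v *)
Require Import Defs.
From mathcomp Require Import all_boot all_order all_algebra finmap.
From mathcomp Require Import cyclic separable cyclotomic complex.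
From mathcomp Require Import all_classical all_reals all_analysis.
From mathcomp Require Import ring lra zify.
From mathcomp Require summability.
Set Implicit Arguments.
Unset Strict Implicit.
Unset Printing Implicit Defensive.
Import Order.TTheory GRing.Theory Num.Theory.
Import numFieldNormedType.Exports.
Local Open Scope classical_set_scope.
Local Open Scope ring_scope.

(* Boundedness of f is used only on finite-dimensional sections, where it bounds
   large finite parts of the monomial series on polydiscs.

   Inclusion.  For r >= 2 write z = x y with x in the unit ball of l_r and y in
   l_2, sup |y| < 1: Parseval bounds the sum of |c_a x^a|^2, and Cauchy-Schwarz
   concludes.  For r < 2 use Cauchy's inequality |c_a| rho^a <= M with a radius
   rho depending on a: close to |z| in the first variables, and proportional to
   a / |a| in the remaining ones, where z has small l_1 norm.

   Properness.  The derivative of f in a direction u gains a factor, because it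
   bounds the sum over k of u_k |d_k f|.  For r >= 2 this is combined with the
   comparison of the L^1 and L^2 norms of homogeneous polynomials on the torus
   (fourth moments), and shows that x_k / (8 sqrt (k+2)) is a point of monomial
   convergence for every x in the ball.  For r < 2 the coefficient of the derivative
   at a fixed multi-index b bounds the sum over k of u_k |c_(b+e_k)|; on blocks of
   rapidly increasing length n_J the sequence z = A / n_J is then a point of
   monomial convergence, with a gain n_J^(-(1-1/r)) in the block J, although
   its l_1 norm on each block is A. *)

(** * Roots of unity and monomials *)

(** All estimates must be uniform in the number n of variables, since membership is read off from
    finite sums involving finitely many variables. Torus integrals become averages over q-th roots
    of unity, with q above all exponents involved, so that orthogonality is a finite identity.

    In both properness arguments a multi-index is charged to its last variable k ([top a k]), the
    one in which f is differentiated; only the variables up to k then have to be paid for. For r >=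
    2 the price in degree m is 2 * 4^m: a factor 2^(m+1) from comparing L^1 and L^2 norms and 2^m
    from the derivative. Hence the 8, which leaves a summable 2^(-m). For r < 2 the obstacle is the
    head: with N head variables the weights sum to 2 (1 - kappa)^(-N). In the inclusion N depends on
    z alone. In properness N is the start of block J and kappa = 1/2, so a factor 2^N has to be
    beaten by the gain n_J^(-(1-1/r)); this dictates n_J = b^(N+J+1) with b^(1-1/r) >= 2, and the
    extra J + 1 makes the blocks summable. *)

Section RootsOfUnity.
Variable C : numClosedFieldType.

(** In characteristic zero [X^q - 1] is separable, so it has q distinct roots in [C]; q distinct
    q-th roots of unity in a field include a primitive one. *)
Lemma exists_prim_root (q : nat) : (0 < q)%N ->
  exists zeta : C, q.-primitive_root zeta.
Proof.
move=> q0.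
have [rs rsE] := closed_field_poly_normal ('X^q - 1 : {poly C}).
have {rsE}: 'X^q - 1 = \prod_(z <- rs) ('X - z%:P) :> {poly C}.
  by rewrite rsE lead_coefDl ?size_polyXn ?size_polyN ?size_poly1//
    ?lead_coefXn ?scale1r.
move=> rsE; have srs : size rs = q.
  have := congr1 (fun p : {poly C} => size p) rsE.
  by rewrite size_prod_XsubC size_XnsubC// => -[].
suff /hasP[z _ hz] : has q.-primitive_root rs by exists z.
apply: has_prim_root => //; last by rewrite srs.
- apply/allP => z zrs; rewrite /root_of_unity rsE.
  by rewrite root_prod_XsubC.
- rewrite -separable_prod_XsubC -rsE; apply: separable_Xn_sub_1.
  by rewrite pnatr_eq0 -lt0n.
Qed.

Variables (q : nat) (zeta : C).
Hypothesis hz : q.-primitive_root zeta.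

Let q0 : (0 < q)%N := prim_order_gt0 hz.

Lemma norm_prim_root : `|zeta| = 1.
Proof.
by apply/eqP; rewrite -(pexpr_eq1 q0)// -normrX prim_expr_order// normr1.
Qed.

Lemma conj_prim_rootX k : (zeta ^+ k)^* = (zeta ^+ k)^-1.
Proof.
by rewrite [RHS]invC_norm normrX norm_prim_root !expr1n invr1 mul1r.
Qed.

Lemma sum_prim_root a b : (a < q)%N -> (b < q)%N ->
  \sum_(j < q) (zeta ^+ j) ^+ a * ((zeta ^+ j) ^+ b)^* = q%:R * (a == b)%:R.
Proof.
move=> aq bq; have z0 : zeta != 0.
  by rewrite -normr_eq0 norm_prim_root oner_eq0.
have zb : zeta ^+ b != 0 by rewrite expf_neq0.
transitivity (\sum_(j < q) (zeta ^+ a / zeta ^+ b) ^+ j).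
  apply: eq_bigr => j _; rewrite -!exprM conj_prim_rootX expr_div_n -!exprM.
  by rewrite [(a * _)%N]mulnC [(b * _)%N]mulnC.
have [->|ab] := eqVneq a b.
  rewrite divff// (eq_bigr (fun=> 1)) => [|j _]; last by rewrite expr1n.
  by rewrite sumr_const card_ord mulr1.
(* Distinct exponents below [q] give a ratio x other than 1, and the geometric sum of x vanishes
   because x^q = 1. *)
have x1 : zeta ^+ a / zeta ^+ b - 1 != 0.
  rewrite subr_eq0 -(divff zb) (inj_eq (mulIf _)) ?invr_eq0//.
  by rewrite (eq_prim_root_expr hz) !modn_small.
rewrite mulr0; apply: (mulfI x1); rewrite -subrX1 mulr0.
have e k : (zeta ^+ k) ^+ q = 1 by rewrite exprAC (prim_expr_order hz) expr1n.
by rewrite expr_div_n !e divr1 subrr.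
Qed.

Lemma sum_prim_root_poly (g : {poly C}) m : (size g <= q)%N -> (m < q)%N ->
  \sum_(j < q) g.[zeta ^+ j] * ((zeta ^+ j) ^+ m)^* = q%:R * g`_m.
Proof.
move=> gq mq.
under eq_bigr do rewrite (horner_coef_wide _ gq) big_distrl/=.
rewrite exchange_big/= (bigD1 (Ordinal mq))//= [X in _ + X]big1 ?addr0.
  under eq_bigr do rewrite -mulrA.
  by rewrite -mulr_sumr sum_prim_root// eqxx mulr1 mulrC.
move=> i im; under eq_bigr do rewrite -mulrA.
rewrite -mulr_sumr sum_prim_root// (_ : _ == _ = false) ?mulr0//.
by apply: contraNF im => /eqP im; apply/eqP/val_inj.
Qed.

Variable n : nat.

(** A finite grid standing in for the torus: monomials with all exponents below [q] are orthonormal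
    for the average over it. *)
Definition torus_pt (t : {ffun 'I_n -> 'I_q}) (i : 'I_n) : C := zeta ^+ t i.

Lemma norm_torus_pt t i : `|torus_pt t i| = 1.
Proof. by rewrite normrX norm_prim_root expr1n. Qed.

End RootsOfUnity.

(** Kept over an arbitrary commutative semiring because it is evaluated at complex points, at their
    moduli and at one-variable polynomials. *)
Definition mon {C : comPzSemiRingType} n (a : {ffun 'I_n -> nat}) (w : 'I_n -> C) : C :=
  \prod_i w i ^+ a i.

Section Orthogonality.
Variables (C : numClosedFieldType) (q : nat) (zeta : C).
Hypothesis hz : q.-primitive_root zeta.
Variable n : nat.

Lemma mon_orthogonal (a b : {ffun 'I_n -> nat}) :
  (forall i, a i < q)%N -> (forall i, b i < q)%N ->
  \sum_(t : {ffun 'I_n -> 'I_q}) mon a (torus_pt zeta t) * (mon b (torus_pt zeta t))^*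
    = (q ^ n)%:R * (a == b)%:R.
Proof.
move=> aq bq.
transitivity (\sum_(t : {ffun 'I_n -> 'I_q})
    \prod_i ((zeta ^+ t i) ^+ a i * ((zeta ^+ t i) ^+ b i)^*)).
  by apply: eq_bigr => t _; rewrite /mon rmorph_prod/= -big_split.
rewrite -(bigA_distr_bigA (fun i (j : 'I_q) => (zeta ^+ j) ^+ a i * ((zeta ^+ j) ^+ b i)^*)).
under eq_bigr do rewrite (sum_prim_root hz)//.
rewrite big_split/= prodr_const card_ord natrX; congr (_ * _).
have [->|ab] := eqVneq a b; first by rewrite big1// => i _; rewrite eqxx.
have [i abi] : exists i, a i != b i.
  apply/existsP; rewrite -negb_forall; apply: contra ab => /forallP h.
  by apply/eqP/ffunP => i; apply/eqP.
by rewrite (bigD1 i)//= (negbTE abi) mul0r.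
Qed.

(** The exponent map [e] may repeat values: it later runs over pairs of multi-indices with the same
    sum, and over the terms of a derivative. *)
Lemma sum_torus_mul_conj (T : eqType) (r : seq T) (e : T -> {ffun 'I_n -> nat})
    (F : T -> C) (b : {ffun 'I_n -> nat}) :
  (forall x i, x \in r -> e x i < q)%N -> (forall i, b i < q)%N ->
  \sum_(t : {ffun 'I_n -> 'I_q})
     (\sum_(x <- r) F x * mon (e x) (torus_pt zeta t)) * (mon b (torus_pt zeta t))^*
   = (q ^ n)%:R * \sum_(x <- r | e x == b) F x.
Proof.
move=> eq bq; rewrite mulr_sumr [RHS]big_mkcond/=.
under eq_bigr do rewrite mulr_suml.
rewrite exchange_big; apply: eq_big_seq => x xr.
under eq_bigr do rewrite -mulrA.
rewrite -mulr_sumr mon_orthogonal//; last by move=> i; exact: eq.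
by case: eqP; rewrite ?mulr0// mulr1 mulrC.
Qed.

Lemma sum_torus_normX2 (T : eqType) (r : seq T) (e : T -> {ffun 'I_n -> nat}) (F : T -> C) :
  (forall x i, x \in r -> e x i < q)%N ->
  \sum_(t : {ffun 'I_n -> 'I_q}) `|\sum_(x <- r) F x * mon (e x) (torus_pt zeta t)| ^+ 2
   = (q ^ n)%:R * \sum_(y <- r) (F y)^* * \sum_(x <- r | e x == e y) F x.
Proof.
move=> eq; rewrite mulr_sumr.
transitivity (\sum_(t : {ffun 'I_n -> 'I_q}) \sum_(y <- r) (F y)^* *
    ((\sum_(x <- r) F x * mon (e x) (torus_pt zeta t)) * (mon (e y) (torus_pt zeta t))^*)).
  apply: eq_bigr => t _; rewrite normCKC rmorph_sum mulr_suml.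
  by apply: eq_bigr => y _; rewrite rmorphM -mulrA [_^* * (\sum_(x <- _) _)]mulrC.
rewrite exchange_big; apply: eq_big_seq => y yr /=.
rewrite -mulr_sumr sum_torus_mul_conj//; last by move=> i; exact: eq.
by rewrite mulrCA.
Qed.

End Orthogonality.

Lemma ler_sum_subset (R : numDomainType) (T : eqType) (s1 s2 : seq T) (G : T -> R) :
  uniq s1 -> {subset s1 <= s2} -> (forall x, 0 <= G x) ->
  \sum_(x <- s1) G x <= \sum_(x <- s2) G x.
Proof.
move=> u1 s12 G0.
have -> : \sum_(x <- s1) G x = \sum_(x <- undup s2 | x \in s1) G x.
  rewrite -[RHS]big_filter; apply: perm_big; apply: uniq_perm => //.
    by rewrite filter_uniq// undup_uniq.
  move=> x; rewrite mem_filter mem_undup.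
  by case: (boolP (x \in s1)) => // /s12 ->.
apply: (@le_trans _ _ (\sum_(x <- undup s2) G x)).
  by rewrite big_mkcond/=; apply: ler_sum => x _; case: ifP.
elim: s2 {s12} => // x s2 ih /=; case: ifP => _; rewrite !big_cons.
  by apply: (le_trans ih); rewrite lerDr.
by rewrite lerD2l.
Qed.

(** Enlarging [s] to the full box of exponents below [q] makes the sum factorise over the
    variables. *)
Lemma ler_sum_box (R : numDomainType) n q (s : seq {ffun 'I_n -> nat}) (F : 'I_n -> nat -> R) :
  uniq s -> (forall a i, a \in s -> (a i < q)%N) -> (forall i b, 0 <= F i b) ->
  \sum_(a <- s) \prod_i F i (a i) <= \prod_i \sum_(b < q) F i b.
Proof.
move=> us sq F0.
pose psi (t : {ffun 'I_n -> 'I_q}) : {ffun 'I_n -> nat} := [ffun i => val (t i)].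
rewrite (bigA_distr_bigA (fun i (j : 'I_q) => F i j)).
rewrite [leRHS](_ : _ = \sum_(a <- map psi (enum {ffun 'I_n -> 'I_q})) \prod_i F i (a i)).
  apply: ler_sum_subset => // [a sa|a]; last by apply: prodr_ge0.
  apply/mapP; exists [ffun i => Ordinal (sq a i sa)]; first by rewrite mem_enum.
  by apply/ffunP => i; rewrite !ffunE.
rewrite big_map big_enum/=; apply: eq_bigr => t _.
by apply: eq_bigr => i _; rewrite ffunE.
Qed.

(** * Averages over roots of unity *)

Section Modulus.
Variable R : rcfType.
Implicit Types z : R[i].
Local Notation normc := (@Normc.normc R).

Lemma normr_complex z : `|z| = ((normc z)%:C)%C.
Proof. by case: z. Qed.

Lemma normc_ge0 z : 0 <= normc z.
Proof. by case: z => a b; exact: sqrtr_ge0. Qed.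

Lemma normc_real (x : R) : normc (x%:C)%C = `|x|.
Proof. by rewrite /= expr0n addr0 sqrtr_sqr. Qed.

Lemma normc_sum (I : Type) (r : seq I) (P : pred I) (F : I -> R[i]) :
  normc (\sum_(i <- r | P i) F i) <= \sum_(i <- r | P i) normc (F i).
Proof.
by elim/big_rec2: _ => [|i y x _ h]; [rewrite Normc.normc0|
  apply: (le_trans (le_normcD _ _)); rewrite lerD2l].
Qed.

Lemma normc_prod (I : Type) (r : seq I) (P : pred I) (F : I -> R[i]) :
  normc (\prod_(i <- r | P i) F i) = \prod_(i <- r | P i) normc (F i).
Proof.
by elim/big_rec2: _ => [|i y x _ h]; rewrite ?Normc.normc1// Normc.normcM h.
Qed.

Lemma normcX z k : normc (z ^+ k) = normc z ^+ k.
Proof. by elim: k => [|k ih]; rewrite ?Normc.normc1// !exprS Normc.normcM ih. Qed.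

Lemma normc_nat k : normc (k%:R : R[i]) = k%:R.
Proof. by rewrite (_ : k%:R = (k%:R%:C)%C) ?normc_real ?normr_nat// rmorph_nat. Qed.

Lemma normc_conj z : normc (z^*) = normc z.
Proof. by apply: complexI; rewrite -!normr_complex norm_conjC. Qed.

Lemma normc_mon n (a : {ffun 'I_n -> nat}) (w : 'I_n -> R[i]) :
  normc (mon a w) = mon a (normc \o w).
Proof. by rewrite normc_prod; apply: eq_bigr => i _; rewrite normcX. Qed.

End Modulus.

Lemma mon_ge0 (R : numDomainType) n (a : {ffun 'I_n -> nat}) (x : 'I_n -> R) :
  (forall i, 0 <= x i) -> 0 <= mon a x.
Proof. by move=> x0; apply: prodr_ge0 => i _; rewrite exprn_ge0. Qed.

Lemma monM (R : comPzSemiRingType) n (a : {ffun 'I_n -> nat}) (x y : 'I_n -> R) :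
  mon a (fun i => x i * y i) = mon a x * mon a y.
Proof. by rewrite /mon -big_split; apply: eq_bigr => i _; rewrite exprMn. Qed.

Lemma monD (R : comPzSemiRingType) n (a b : {ffun 'I_n -> nat}) (x : 'I_n -> R) :
  mon [ffun i => a i + b i]%N x = mon a x * mon b x.
Proof. by rewrite /mon -big_split; apply: eq_bigr => i _; rewrite ffunE exprD. Qed.

Section TorusAverages.
Variables (R : rcfType) (q : nat) (zeta : R[i]).
Hypothesis hz : q.-primitive_root zeta.
Variable n : nat.
Implicit Types (s : seq {ffun 'I_n -> nat}) (c : {ffun 'I_n -> nat} -> R[i]).
Local Notation normc := (@Normc.normc R).

Lemma normc_torus_pt (t : {ffun 'I_n -> 'I_q}) i : normc (torus_pt zeta t i) = 1.
Proof. by apply: complexI; rewrite -normr_complex (norm_torus_pt hz). Qed.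

Lemma normc_mon_torus a (t : {ffun 'I_n -> 'I_q}) : normc (mon a (torus_pt zeta t)) = 1.
Proof.
rewrite normc_mon /mon big1// => i _.
by rewrite /= normc_torus_pt expr1n.
Qed.

Let q0 : (0 < q)%N := prim_order_gt0 hz.
Let qn0 : 0 < (q ^ n)%:R :> R. Proof. by rewrite ltr0n expn_gt0 q0. Qed.

Lemma coef_le_torus (T : eqType) (r : seq T) (e : T -> {ffun 'I_n -> nat})
    (F : T -> R[i]) (b : {ffun 'I_n -> nat}) (M : R) :
  (forall x i, x \in r -> e x i < q)%N -> (forall i, b i < q)%N ->
  (forall t : {ffun 'I_n -> 'I_q},
     normc (\sum_(x <- r) F x * mon (e x) (torus_pt zeta t)) <= M) ->
  normc (\sum_(x <- r | e x == b) F x) <= M.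
Proof.
move=> eq bq PM; rewrite -(ler_pM2l qn0) -[X in X * normc _](normc_nat R).
rewrite -Normc.normcM -(sum_torus_mul_conj hz)//.
apply: (le_trans (normc_sum _ _ _)).
apply: (@le_trans _ _ (\sum_(t : {ffun 'I_n -> 'I_q}) M)).
  by apply: ler_sum => t _; rewrite Normc.normcM normc_conj normc_mon_torus mulr1.
by rewrite sumr_const card_ffun !card_ord mulr_natl.
Qed.

(** Expanding the square pairs terms with equal exponents; bounding |F x F y| by half of |F x|^2 +
    |F y|^2 charges each term once per term sharing its exponent. *)
Lemma torus_mean_square_le (T : eqType) (r : seq T) (e : T -> {ffun 'I_n -> nat})
    (F : T -> R[i]) :
  (forall x i, x \in r -> e x i < q)%N ->
  \sum_(t : {ffun 'I_n -> 'I_q}) normc (\sum_(x <- r) F x * mon (e x) (torus_pt zeta t)) ^+ 2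
   <= (q ^ n)%:R * \sum_(x <- r) normc (F x) ^+ 2 * (count (fun y => e y == e x) r)%:R.
Proof.
move=> eq; have := sum_torus_normX2 hz F eq.
under eq_bigr do rewrite normr_complex -rmorphXn.
rewrite -rmorph_sum/= => E.
rewrite -[leLHS]ger0_norm; last by apply: sumr_ge0 => t _; rewrite exprn_ge0 ?normc_ge0.
rewrite -normc_real E Normc.normcM normc_nat ler_pM2l//.
apply: (le_trans (normc_sum _ _ _)).
pose G x y := if e x == e y then normc (F x) ^+ 2 / 2 else 0.
apply: (@le_trans _ _ (\sum_(y <- r) \sum_(x <- r) (G x y + G y x))).
  apply: ler_sum => y _; rewrite Normc.normcM normc_conj.
  apply: (@le_trans _ _ (normc (F y) * \sum_(x <- r | e x == e y) normc (F x))).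
    by rewrite ler_wpM2l ?normc_ge0 ?normc_sum.
  rewrite big_mkcond mulr_sumr; apply: ler_sum => x _.
  rewrite /G [e y == _]eq_sym; case: ifP => _; last by rewrite mulr0 addr0.
  have := sqr_ge0 (normc (F x) - normc (F y)); nra.
have GE x : \sum_(y <- r) G x y = normc (F x) ^+ 2 / 2 * (count (fun y => e y == e x) r)%:R.
  rewrite -sum1_count natr_sum mulr_sumr [RHS]big_mkcond/=; apply: eq_bigr => y _.
  by rewrite /G eq_sym mulr1.
have -> : \sum_(y <- r) \sum_(x <- r) (G x y + G y x) =
    \sum_(y <- r) \sum_(x <- r) G x y + \sum_(y <- r) \sum_(x <- r) G y x.
  by rewrite -big_split; apply: eq_bigr => y _; rewrite big_split.
rewrite exchange_big -big_split; apply: ler_sum => x _ /=.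
rewrite GE -mulrDl; apply: ler_wpM2r; first exact: ler0n.
by rewrite -splitr.
Qed.

Lemma torus_mean_square s c : uniq s -> (forall a i, a \in s -> a i < q)%N ->
  \sum_(t : {ffun 'I_n -> 'I_q}) normc (\sum_(a <- s) c a * mon a (torus_pt zeta t)) ^+ 2
   = (q ^ n)%:R * \sum_(a <- s) normc (c a) ^+ 2.
Proof.
move=> us sq; apply: complexI; rewrite rmorphM/= !rmorph_sum/=.
under eq_bigr do rewrite rmorphXn/= -normr_complex.
rewrite (sum_torus_normX2 hz (e := id))// rmorph_nat; congr (_ * _).
apply: eq_big_seq => a sa.
rewrite rmorphXn/= -normr_complex normCKC; congr (_ * _).
rewrite -big_filter (_ : seq.filter _ _ = [:: a]) ?big_seq1//.
by rewrite filter_pred1_uniq.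
Qed.

Lemma torus_bessel s c (M : R) : uniq s -> (forall a i, a \in s -> a i < q)%N ->
  (forall t : {ffun 'I_n -> 'I_q}, normc (\sum_(a <- s) c a * mon a (torus_pt zeta t)) <= M) ->
  \sum_(a <- s) normc (c a) ^+ 2 <= M ^+ 2.
Proof.
move=> us sq PM; rewrite -(ler_pM2l qn0) -torus_mean_square//.
rewrite (_ : _ * _ = \sum_(t : {ffun 'I_n -> 'I_q}) M ^+ 2); last first.
  by rewrite sumr_const card_ffun !card_ord mulr_natl.
by apply: ler_sum => t _; rewrite lerXn2r ?nnegrE ?normc_ge0// (le_trans _ (PM t)) ?normc_ge0.
Qed.

(** A pair with sum [g] is determined by its first entry, which lies below [g]; there are prod (g_i
    + 1) <= prod 2^(g_i) such entries. *)
Lemma count_add_le s (g : {ffun 'I_n -> nat}) : uniq s ->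
  (count (fun p : {ffun 'I_n -> nat} * {ffun 'I_n -> nat} =>
      [ffun i => p.1 i + p.2 i]%N == g) [seq (a, b) | a <- s, b <- s]
    <= 2 ^ \sum_i g i)%N.
Proof.
move=> us; rewrite -size_filter; set r := seq.filter _ _.
have ur : uniq r by rewrite filter_uniq// allpairs_uniq// => -[a b] [c d] _ _.
have rg p i : p \in r -> (p.1 i + p.2 i)%N = g i.
  by rewrite mem_filter => /andP[/eqP <-]; rewrite ffunE.
have u1 : uniq (map fst r).
  rewrite map_inj_in_uniq// => -[a b] [a' b'] hr hr' /= E; rewrite E in hr *.
  congr pair; apply/ffunP => i; apply/eqP.
  by rewrite -(eqn_add2l (a' i)) (rg _ i hr) (rg _ i hr').
have r1 a i : a \in map fst r -> (a i < (\sum_i g i).+1)%N.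
  move=> /mapP[p pr ->]; rewrite ltnS (bigD1 i)//= -(rg p i pr) -addnA.
  exact: leq_addr.
rewrite -(size_map fst) -(ler_nat R) -sum1_size natr_sum.
apply: (@le_trans _ _ (\sum_(a <- map fst r) \prod_i (a i <= g i)%N%:R)).
  rewrite big_seq [leRHS]big_seq ler_sum// => a /mapP[p pr ->].
  rewrite big1// => i _; rewrite (_ : (_ <= _)%N)//.
  by rewrite -(rg p i pr) leq_addr.
apply: (le_trans (ler_sum_box (F := fun i b => (b <= g i)%N%:R) u1 r1 _)).
  by move=> *; exact: ler0n.
rewrite expn_sum natr_prod; apply: ler_prod => i _; apply/andP; split.
  by apply: sumr_ge0 => b _; exact: ler0n.
rewrite -natr_sum ler_nat.
suff -> : (\sum_(b < (\sum_i g i).+1) (b <= g i))%N = minn (\sum_i g i).+1 (g i).+1.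
  exact: leq_trans (geq_minr _ _) (ltn_expl _ _).
elim: (\sum_i g i).+1 => [|N ih]; first by rewrite big_ord0 min0n.
by rewrite big_ord_recr/= ih; lia.
Qed.

(** The fourth moment of P is the mean square of P^2 expanded over pairs, where an exponent of
    degree at most 2d comes from at most 2^(2d) = 4^d pairs. *)
Lemma torus_fourth_moment s c d : uniq s ->
  (forall a i, a \in s -> a i + a i < q)%N -> (forall a, a \in s -> \sum_i a i <= d)%N ->
  \sum_(t : {ffun 'I_n -> 'I_q}) normc (\sum_(a <- s) c a * mon a (torus_pt zeta t)) ^+ 4
   <= (q ^ n)%:R * (4 ^+ d * (\sum_(a <- s) normc (c a) ^+ 2) ^+ 2).
Proof.
move=> us sq sd.
pose r := [seq (a, b) | a <- s, b <- s].
pose e (p : {ffun 'I_n -> nat} * {ffun 'I_n -> nat}) : {ffun 'I_n -> nat} :=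
  [ffun i => p.1 i + p.2 i]%N.
have E (t : {ffun 'I_n -> 'I_q}) :
    normc (\sum_(a <- s) c a * mon a (torus_pt zeta t)) ^+ 4 =
    normc (\sum_(p <- r) c p.1 * c p.2 * mon (e p) (torus_pt zeta t)) ^+ 2.
  rewrite -[4%N]/(2 * 2)%N exprM -normcX; congr (normc _ ^+ 2).
  rewrite big_allpairs expr2 mulr_suml; apply: eq_bigr => a _.
  by rewrite mulr_sumr; apply: eq_bigr => b _; rewrite monD mulrACA.
under eq_bigr do rewrite E.
have rs p : p \in r -> (p.1 \in s) /\ (p.2 \in s) by case/allpairsP => -[a b] [? ? ->].
apply: (le_trans (torus_mean_square_le _ _)).
  move=> p i /rs[p1 p2]; rewrite ffunE.
  by move: (sq _ i p1) (sq _ i p2); move: (p.1 i) (p.2 i) => x y; lia.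
rewrite ler_pM2l//.
rewrite (_ : 4 ^+ d * _ = \sum_(p <- r) normc (c p.1 * c p.2) ^+ 2 * 4 ^+ d); last first.
  rewrite -mulr_suml mulrC; congr (_ * _).
  rewrite big_allpairs expr2 mulr_suml; apply: eq_bigr => a _.
  by rewrite mulr_sumr; apply: eq_bigr => b _; rewrite Normc.normcM exprMn.
rewrite big_seq [leRHS]big_seq; apply: ler_sum => p /rs[p1 p2].
rewrite ler_wpM2l ?exprn_ge0 ?normc_ge0//.
apply: (@le_trans _ _ (2 ^ \sum_i e p i)%:R); first by rewrite ler_nat count_add_le.
rewrite -natrX ler_nat -[4%N]/(2 ^ 2)%N -expnM leq_pexp2l//.
under eq_bigr do rewrite ffunE.
by rewrite big_split/= mul2n -addnn leq_add// sd.
Qed.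

(* The pointwise bound [X/l >= (X/l)^2 - (X/l)^4 / 4] turns the comparison of
   the second and fourth moments into one of the first and second moments. *)
Lemma torus_khinchine s c d : uniq s ->
  (forall a i, a \in s -> a i + a i < q)%N -> (forall a, a \in s -> \sum_i a i <= d)%N ->
  (q ^ n)%:R * Num.sqrt (\sum_(a <- s) normc (c a) ^+ 2) <= 2 ^+ d.+1 *
  \sum_(t : {ffun 'I_n -> 'I_q}) normc (\sum_(a <- s) c a * mon a (torus_pt zeta t)).
Proof.
move=> us sq sd; set S2 := \sum_(a <- s) _; set N1 := \sum_t _.
have S20 : 0 <= S2 by apply: sumr_ge0 => a _; rewrite exprn_ge0 ?normc_ge0.
have N10 : 0 <= N1 by apply: sumr_ge0 => a _; exact: normc_ge0.
have [->|S2n] := eqVneq S2 0.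
  by rewrite sqrtr0 mulr0 mulr_ge0// exprn_ge0.
set sg := Num.sqrt S2; have sg0 : 0 < sg by rewrite sqrtr_gt0 lt_def S2n.
have S2E : S2 = sg ^+ 2 by rewrite sqr_sqrtr.
set K : R := 2 ^+ d; have K1 : 0 < K by rewrite exprn_gt0.
(* With this scale the second moment contributes Q / K^2, where Q = q^n, and the fourth at most a
   quarter of that, so 3/4 survives. *)
pose l := K * sg; have l0 : 0 < l by rewrite mulr_gt0.
pose X (t : {ffun 'I_n -> 'I_q}) : R := normc (\sum_(a <- s) c a * mon a (torus_pt zeta t)).
have pt t : X t / l >= X t ^+ 2 / l ^+ 2 - X t ^+ 4 / (4 * l ^+ 4).
  have : 0 <= X t / l by rewrite divr_ge0 ?normc_ge0// ltW.
  rewrite -expr_div_n (_ : X t ^+ 4 / (4 * l ^+ 4) = (X t / l) ^+ 4 / 4); last first.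
    by rewrite expr_div_n; field; rewrite gt_eqF.
  set y := X t / l => y0.
  suff : 0 <= y * (1 - y + y ^+ 3 / 4) by nra.
  rewrite mulr_ge0//.
  (* The factor equals y (y - 1)^2 / 4 + (4 y - 5)^2 / 32 + 7/32. *)
  by have := mulr_ge0 y0 (sqr_ge0 (y - 1)); have := sqr_ge0 (4 * y - 5); lra.
have q2 (a : _) i : a \in s -> (a i < q)%N by move=> /sq -/(_ i); lia.
have m2 := torus_mean_square c us q2; rewrite -/S2 in m2.
have m4 := torus_fourth_moment c us sq sd; rewrite -/S2 in m4.
have : N1 / l >= (\sum_t X t ^+ 2) / l ^+ 2 - (\sum_t X t ^+ 4) / (4 * l ^+ 4).
  by rewrite /N1 !mulr_suml -sumrB; apply: ler_sum => t _; exact: pt.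
rewrite m2 => h.
have {}h : N1 / l >=
    (q ^ n)%:R * S2 / l ^+ 2 - ((q ^ n)%:R * (4 ^+ d * S2 ^+ 2)) / (4 * l ^+ 4).
  apply: le_trans h; rewrite lerB// ler_wpM2r// invr_ge0.
  by rewrite mulr_ge0// exprn_ge0// ltW.
have K4 : 4 ^+ d = K ^+ 2 by rewrite /K -exprM mulnC exprM; congr (_ ^+ d); ring.
have {}h : N1 / (K * sg) >= 3 / 4 * (q ^ n)%:R / K ^+ 2.
  apply: le_trans h; rewrite S2E K4 /l le_eqVlt; apply/orP; left; apply/eqP.
  have E (Q k x : R) : 0 < k -> 0 < x -> 3 / 4 * Q / k ^+ 2 =
    Q * x ^+ 2 / (k * x) ^+ 2 - Q * (k ^+ 2 * (x ^+ 2) ^+ 2) / (4 * (k * x) ^+ 4).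
    by move=> k0 x0; field; rewrite !gt_eqF.
  exact: E.
have {}h : 3 / 4 * (q ^ n)%:R * sg <= K * N1.
  rewrite ler_pdivlMr ?mulr_gt0// in h.
  have E (Q k x : R) : 0 < k -> 3 / 4 * Q * x = k * (3 / 4 * Q / k ^+ 2 * (k * x)).
    by move=> k0; field; rewrite gt_eqF.
  by rewrite (E _ K sg K1) ler_pM2l.
have Qs : 0 <= (q ^ n)%:R * sg by rewrite mulr_ge0 ?ler0n// ltW.
rewrite exprS -/K -mulrA; apply: le_trans (_ : 2 * (3 / 4 * (q ^ n)%:R * sg) <= _).
  move: Qs; rewrite -(mulrA (3 / 4)); move: (_ * sg) => y; lra.
by rewrite ler_pM2l.
Qed.

End TorusAverages.

(** * One-variable coefficient extraction *)

Section CoefOne.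
Variable A : comNzRingType.
Implicit Types p : {poly A}.

Lemma coef1M p1 p2 : (p1 * p2)`_1 = p1`_1 * p2`_0 + p1`_0 * p2`_1.
Proof. by rewrite coefM !big_ord_recl big_ord0 /= addr0 addrC. Qed.

Lemma coef1_exp p m : (p ^+ m)`_1 = m%:R * p`_1 * p`_0 ^+ m.-1.
Proof.
elim: m => [|[|m] ih]; first by rewrite coef1 !mul0r.
  by rewrite !mul1r mulr1.
rewrite exprS coef1M ih -[X in p`_1 * X]horner_coef0 horner_exp horner_coef0 /=.
by rewrite -[m.+2]addn1 natrD exprS; ring.
Qed.

Lemma coef1_prod (I : eqType) (r : seq I) (F : I -> {poly A}) : uniq r ->
  (\prod_(i <- r) F i)`_1 = \sum_(k <- r) (F k)`_1 * \prod_(i <- r | i != k) (F i)`_0.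
Proof.
elim: r => [|j r ih]; first by rewrite !big_nil coef1.
move=> /= /andP[jr ur]; rewrite !big_cons eqxx coef1M ih//; congr (_ + _).
  rewrite coef0_prod; congr (_ * _); rewrite [LHS]big_seq [RHS]big_seq_cond.
  apply: eq_bigl => i; case: (boolP (i \in r)) => //= ir.
  by apply/esym; apply: contraNneq jr => <-.
rewrite mulr_sumr; apply: eq_big_seq => k kr; rewrite big_cons mulrCA.
by rewrite (_ : j != k)//; apply: contraNneq jr => ->.
Qed.

End CoefOne.

(** Subtraction is truncated: at [a k = 0] the result is [a] itself, a default that the factor [a k]
    of the derivative annihilates. *)
Definition decr n (a : {ffun 'I_n -> nat}) (k : 'I_n) : {ffun 'I_n -> nat} :=
  [ffun i => (a i - (i == k))%N].

Definition incr n (a : {ffun 'I_n -> nat}) (k : 'I_n) : {ffun 'I_n -> nat} :=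
  [ffun i => (a i + (i == k))%N].

Definition deg n (a : {ffun 'I_n -> nat}) : nat := (\sum_i a i)%N.

Lemma leq_deg n (a : {ffun 'I_n -> nat}) i : (a i <= deg a)%N.
Proof. by rewrite /deg (bigD1 i)//= leq_addr. Qed.

Lemma mon_decr (A : comPzSemiRingType) n (a : {ffun 'I_n -> nat}) k (x : 'I_n -> A) :
  mon (decr a k) x = x k ^+ (a k).-1 * \prod_(i | i != k) x i ^+ a i.
Proof.
rewrite /mon (bigD1 k)//= ffunE eqxx subn1; congr (_ * _).
by apply: eq_bigr => i ik; rewrite ffunE (negbTE ik) subn0.
Qed.

Lemma mon_decrK (A : comPzSemiRingType) n (a : {ffun 'I_n -> nat}) k (x : 'I_n -> A) :
  (0 < a k)%N -> mon a x = x k * mon (decr a k) x.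
Proof.
by move=> ak; rewrite mon_decr mulrA -exprS prednK// /mon (bigD1 k).
Qed.

Lemma coef1_mon (A : comNzRingType) n (a : {ffun 'I_n -> nat}) (x u : 'I_n -> A) :
  (mon a (fun i => (x i)%:P + (u i)%:P * 'X) : {poly A})`_1 =
  \sum_k (a k)%:R * u k * mon (decr a k) x.
Proof.
rewrite [in LHS]/mon -big_enum coef1_prod ?enum_uniq// big_enum; apply: eq_bigr => k _.
rewrite mon_decr coef1_exp !coefD !coefMX !coefC /= addr0 add0r -!mulrA.
congr (_ * (_ * (_ * _))); rewrite big_enum_cond; apply: eq_bigr => i _.
by rewrite -horner_coef0 !hornerE.
Qed.

Lemma horner_mon (A : comNzRingType) n (a : {ffun 'I_n -> nat}) (f : 'I_n -> {poly A}) t :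
  (mon a f).[t] = mon a (fun i => (f i).[t]).
Proof. by rewrite horner_prod; apply: eq_bigr => i _; rewrite horner_exp. Qed.

Lemma mon_scale (A : comPzSemiRingType) n (a : {ffun 'I_n -> nat}) (t : A) (w : 'I_n -> A) :
  mon a (fun i => t * w i) = t ^+ deg a * mon a w.
Proof. by rewrite monM /mon /deg -prodrXr. Qed.

(** * Cauchy estimates for polynomials *)

Section Bounds.
Variable R : rcfType.
Local Notation normc := (@Normc.normc R).

(** Cauchy's inequality on the unit circle, as an average over roots of unity of order above both
    [m] and the degree. *)
Lemma coef_poly_le (g : {poly R[i]}) m (M : R) :
  (forall t, normc t = 1 -> normc g.[t] <= M) -> normc g`_m <= M.
Proof.
move=> gM; pose q := maxn (size g) m.+1.
have q0 : (0 < q)%N by rewrite leq_max orbT.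
have [zeta hz] := exists_prim_root R[i] q0.
have nz j : normc (zeta ^+ j) = 1.
  by apply: complexI; rewrite -normr_complex normrX (norm_prim_root hz) expr1n.
have q1 : 0 < q%:R :> R by rewrite ltr0n.
rewrite -(ler_pM2l q1) -[X in X * normc _](normc_nat R) -Normc.normcM.
rewrite -(sum_prim_root_poly hz) ?leq_max ?leqnn ?orbT//.
apply: (le_trans (normc_sum _ _ _)); apply: (@le_trans _ _ (\sum_(j < q) M)).
  apply: ler_sum => j _; rewrite Normc.normcM normc_conj normcX nz expr1n mulr1.
  exact: gM.
by rewrite sumr_const card_ord mulr_natl.
Qed.

Variable n : nat.
Implicit Types (s : seq {ffun 'I_n -> nat}) (c : {ffun 'I_n -> nat} -> R[i]).
Implicit Types (w x u : 'I_n -> R[i]).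

Lemma homogeneous_part_le s c w m (M : R) :
  (forall t, normc t = 1 -> normc (\sum_(a <- s) c a * mon a (fun i => t * w i)) <= M) ->
  normc (\sum_(a <- s | deg a == m) c a * mon a w) <= M.
Proof.
move=> PM; pose g : {poly R[i]} := \sum_(a <- s) (c a * mon a w) *: 'X^(deg a).
have -> : \sum_(a <- s | deg a == m) c a * mon a w = g`_m.
  rewrite coef_sum big_mkcond/=; apply: eq_bigr => a _.
  by rewrite coefZ coefXn eq_sym; case: eqP; rewrite ?mulr1 ?mulr0.
apply: coef_poly_le => t /PM; rewrite horner_sum.
by under eq_bigr do rewrite mon_scale mulrCA mulrC -hornerXn -hornerZ.
Qed.

(** The derivative at [x] along [u] is the coefficient of degree one of t -> P(x + t u), so the
    estimate needs P only where |t| = 1. *)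
Lemma directional_derivative_le s c x u (M : R) :
  (forall t, normc t = 1 -> normc (\sum_(a <- s) c a * mon a (fun i => x i + u i * t)) <= M) ->
  normc (\sum_(a <- s) c a * \sum_k (a k)%:R * u k * mon (decr a k) x) <= M.
Proof.
move=> PM; pose g : {poly R[i]} :=
  \sum_(a <- s) c a *: mon a (fun i => (x i)%:P + (u i)%:P * 'X).
have -> : \sum_(a <- s) c a * \sum_k (a k)%:R * u k * mon (decr a k) x = g`_1.
  by rewrite coef_sum; apply: eq_bigr => a _; rewrite coefZ coef1_mon.
apply: coef_poly_le => t /PM; rewrite horner_sum; congr (normc _ <= _).
apply: eq_bigr => a _; rewrite hornerZ horner_mon; congr (_ * _).
by apply: eq_bigr => i _; rewrite !hornerE.
Qed.

Lemma exists_phase (z : R[i]) : exists v, normc v = 1 /\ v * z = ((normc z)%:C)%C.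
Proof.
have [->|z0] := eqVneq z 0.
  by exists 1; rewrite Normc.normc1 Normc.normc0 mulr0.
have nz : normc z != 0 by apply: contra_neq z0; exact: Normc.eq0_normc.
exists (((normc z)%:C)%C / z); rewrite mulfVK// Normc.normcM Normc.normcV normc_real.
by rewrite ger0_norm ?normc_ge0// divff.
Qed.

End Bounds.

(** * Coefficient estimates *)

(* [coef_controlled D c M] is what boundedness by [M] of the function with
   coefficients [c] leaves on the polydiscs whose polyradius satisfies [D]:
   arbitrarily large finite parts of the expansion are bounded by [M]. *)
Definition coef_controlled (R : rcfType) n (D : ('I_n -> R) -> Prop)
    (c : {ffun 'I_n -> nat} -> R[i]) (M : R) :=
  forall rho, D rho -> forall s : seq {ffun 'I_n -> nat},
  exists s', [/\ uniq s', {subset s <= s'} &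
    forall w, (forall i, Normc.normc (w i) <= rho i) ->
      Normc.normc (\sum_(a <- s') c a * mon a w) <= M].

Section Controlled.
Variables (R : rcfType) (n : nat) (D : ('I_n -> R) -> Prop).
Variables (c : {ffun 'I_n -> nat} -> R[i]) (M : R).
Hypothesis hc : coef_controlled D c M.
Implicit Types (rho u : 'I_n -> R) (s : seq {ffun 'I_n -> nat}).
Local Notation normc := (@Normc.normc R).

Lemma exists_deg_bound s : exists d, forall a, a \in s -> (deg a <= d)%N.
Proof.
by exists (\max_(a <- s) deg a) => a sa; apply: (leq_bigmax_seq _ sa).
Qed.

(** The part indexed by [s] need not be bounded, only its enlargement [s'] is; the terms being
    nonnegative, Parseval on the torus of radius [rho] is applied to [s']. *)
Lemma controlled_bessel rho s : D rho -> (forall i, 0 <= rho i) -> uniq s ->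
  \sum_(a <- s) (normc (c a) * mon a rho) ^+ 2 <= M ^+ 2.
Proof.
move=> Drho rho0 us; have [s' [us' ss' PM]] := hc Drho s.
apply: (@le_trans _ _ (\sum_(a <- s') (normc (c a) * mon a rho) ^+ 2)).
  by apply: ler_sum_subset => // a; exact: sqr_ge0.
have [d sd] := exists_deg_bound s'.
have [zeta hz] := exists_prim_root R[i] (ltn0Sn d).
pose rhoC i : R[i] := ((rho i)%:C)%C.
have E a : normc (c a) * mon a rho = normc (c a * mon a rhoC).
  rewrite Normc.normcM normc_mon; congr (_ * _).
  by apply: eq_bigr => i _; rewrite /= expr0n addr0 sqrtr_sqr ger0_norm.
under eq_bigr do rewrite E.
apply: (torus_bessel (n := n) hz) => //.
  by move=> a i /sd; rewrite ltnS; exact/leq_trans/leq_deg.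
move=> t; have := PM (fun i => rhoC i * torus_pt zeta t i).
under eq_bigr do rewrite monM mulrA; apply => i.
by rewrite Normc.normcM (normc_torus_pt hz) mulr1 normc_real ger0_norm.
Qed.

Lemma controlled_cauchy rho a : D rho -> (forall i, 0 <= rho i) -> 0 <= M ->
  normc (c a) * mon a rho <= M.
Proof.
move=> Drho rho0 M0.
have /= := @controlled_bessel rho [:: a] Drho rho0 isT.
by rewrite big_seq1 ler_sqr ?nnegrE// mulr_ge0 ?normc_ge0// mon_ge0.
Qed.

Lemma incrK (b : {ffun 'I_n -> nat}) k : decr (incr b k) k = b.
Proof. by apply/ffunP => i; rewrite !ffunE addnK. Qed.

Lemma decrK (a : {ffun 'I_n -> nat}) k : (0 < a k)%N -> incr (decr a k) k = a.
Proof.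
move=> ak; apply/ffunP => i; rewrite !ffunE.
by case: eqP => [->|_]; rewrite ?subnK ?subn0 ?addn0.
Qed.

(* Boundedness of the derivative in the direction [u], read off at the
   multi-index [b]: the phases of [u] are free, so the coefficients [c (incr b k)]
   are controlled in the dual norm of [u], not merely one by one. *)
Lemma controlled_derivative rho u b :
  D (fun i => rho i + u i) -> (forall i, 0 <= rho i) -> (forall i, 0 <= u i) ->
  (\sum_k u k * normc (c (incr b k))) * mon b rho <= M.
Proof.
move=> Drho rho0 u0; have [s [us ss PM]] := hc Drho [seq incr b k | k <- enum 'I_n].
have [v hv] : exists v : 'I_n -> R[i], forall k, normc (v k) = 1 /\
    v k * c (incr b k) = ((normc (c (incr b k)))%:C)%C.
  by have [v hv] := fin_all_exists (fun k => exists_phase (c (incr b k))); exists v.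
have [d sd] := exists_deg_bound s.
have [zeta hz] := exists_prim_root R[i] (ltn0Sn (d + deg b)).
pose r := [seq (a, k) | a <- s, k <- enum 'I_n].
pose F (p : {ffun 'I_n -> nat} * 'I_n) : R[i] :=
  c p.1 * (p.1 p.2)%:R * (((u p.2)%:C)%C * v p.2) * (mon (decr p.1 p.2) rho)%:C%C.
have := @coef_le_torus _ _ _ hz n _ r (fun p => decr p.1 p.2) F b M.
have rho_real k : mon (decr k.1 k.2) (fun i => (rho i)%:C%C) = (mon (decr k.1 k.2) rho)%:C%C.
  by rewrite /mon rmorph_prod; apply: eq_bigr => i _; rewrite rmorphXn.
have hq p i : p \in r -> (decr p.1 p.2 i < (d + deg b).+1)%N.
  case/allpairsP => -[a k] [/= sa _ ->]; rewrite ffunE ltnS.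
  apply: (leq_trans (leq_subr _ _)); apply: (leq_trans (leq_deg a i)).
  exact: leq_trans (sd _ sa) (leq_addr _ _).
have hb i : (b i < (d + deg b).+1)%N.
  exact: leq_trans (leq_deg b i) (leq_addl _ _).
move=> /(_ hq hb) h.
have {}h : normc (\sum_(p <- r | decr p.1 p.2 == b) F p) <= M.
  apply: h => t.
  (* At a point of the torus of radius [rho] this is the derivative along [u * v], and all points it
     involves have moduli at most [rho + u]. *)
  rewrite (_ : \sum_(p <- r) _ = \sum_(a <- s) c a * \sum_k (a k)%:R *
      ((u k)%:C%C * v k) * mon (decr a k) (fun i => (rho i)%:C%C * torus_pt zeta t i)).
    apply: directional_derivative_le => z z1; apply: PM => i.
    apply: (le_trans (le_normcD _ _)); rewrite !Normc.normcM !normc_real.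
    by rewrite z1 (normc_torus_pt hz) (hv i).1 !mulr1 !ger0_norm.
  rewrite big_allpairs; apply: eq_bigr => a _.
  rewrite mulr_sumr big_enum; apply: eq_bigr => k _.
  by rewrite monM (rho_real (a, k)) /F /=; ring.
apply: le_trans h; rewrite (_ : \sum_(p <- r | _) F p =
   (\sum_k ((incr b k) k)%:R * (u k * normc (c (incr b k))) * mon b rho)%:C%C).
  rewrite normc_real ger0_norm; last first.
    by apply: sumr_ge0 => k _; rewrite !mulr_ge0 ?ler0n ?normc_ge0 ?mon_ge0.
  rewrite mulr_suml; apply: ler_sum => k _; apply: ler_wpM2r; first exact: mon_ge0.
  rewrite ffunE eqxx ler_peMl ?mulr_ge0 ?normc_ge0//.
  by rewrite ler1n addn1.
rewrite big_mkcond big_allpairs exchange_big big_enum rmorph_sum; apply: eq_bigr => k _ /=.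
rewrite -big_mkcond/= (bigID (pred1 (incr b k)))/= [X in _ + X]big1 ?addr0; last first.
  (* If [decr a k = b] but [a] is not [incr b k], the subtraction was truncated: [a k = 0], and the
     term carries this factor. *)
  move=> a /andP[/eqP ab abk]; rewrite /F /=.
  have -> : a k = 0%N.
    apply/eqP; rewrite -leqn0 leqNgt; apply: contraNN abk => ak.
    by rewrite -ab decrK.
  by rewrite mulr0 !mul0r.
rewrite -big_filter (_ : seq.filter _ _ = [:: incr b k]); last first.
  rewrite (eq_filter (a2 := pred1 (incr b k))) ?filter_pred1_uniq//.
    by apply: ss; apply: map_f; rewrite mem_enum.
  by move=> a /=; have [->|_] := eqVneq a (incr b k); rewrite ?incrK ?eqxx ?andbF.
rewrite big_seq1 /F /= incrK !rmorphM/= rmorph_nat -(hv k).2; ring.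
Qed.

End Controlled.

(** * Square-root weights *)

Lemma cauchy_schwarz_seq (R : rcfType) (T : Type) (s : seq T) (f g : T -> R) (G : R) :
  (forall x, 0 <= f x) -> (forall x, 0 <= g x) -> 0 < G -> \sum_(x <- s) g x ^+ 2 <= G ^+ 2 ->
  \sum_(x <- s) f x * g x <= Num.sqrt (\sum_(x <- s) f x ^+ 2) * G.
Proof.
move=> f0 g0 G0 gG; set S := \sum_(x <- s) f x ^+ 2.
have S0 : 0 <= S by apply: sumr_ge0 => x _; exact: sqr_ge0.
(* The mean inequality with a free weight [t]: the optimum is sqrt S / G, and for S = 0 the weight
   is made arbitrarily small. *)
have key (t : R) : 0 < t -> \sum_(x <- s) f x * g x <= (S / t + t * G ^+ 2) / 2.
  move=> t0; apply: (@le_trans _ _ ((S / t + t * \sum_(x <- s) g x ^+ 2) / 2)).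
    rewrite /S mulr_suml mulr_sumr -big_split mulr_suml; apply: ler_sum => x _ /=.
    rewrite -subr_ge0.
    rewrite (_ : _ - _ = (f x - t * g x) ^+ 2 / t / 2); last by field; rewrite gt_eqF.
    by rewrite !divr_ge0 ?sqr_ge0// ltW.
  by rewrite ler_pM2r ?invr_gt0// lerD2l ler_pM2l.
have [S00|Sn] := eqVneq S 0.
  rewrite S00 sqrtr0 mul0r; apply/ler_addgt0Pr => e e0; rewrite add0r.
  have t0 : 0 < 2 * e / G ^+ 2 by rewrite divr_gt0 ?mulr_gt0 ?exprn_gt0.
  apply: (le_trans (key _ t0)); rewrite S00 mul0r add0r le_eqVlt.
  by apply/orP; left; apply/eqP; field; rewrite gt_eqF.
set r := Num.sqrt S; have r0 : 0 < r by rewrite sqrtr_gt0 lt_def Sn.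
have SE : S = r ^+ 2 by rewrite sqr_sqrtr.
apply: (le_trans (key (r / G) (divr_gt0 r0 G0))); rewrite SE le_eqVlt.
by apply/orP; left; apply/eqP; field; rewrite !gt_eqF.
Qed.

Lemma geometric_sum_le (R : realFieldType) (x : R) q : 0 <= x -> x < 1 ->
  \sum_(j < q) x ^+ j <= (1 - x)^-1.
Proof.
move=> x0 x1; have y0 : 0 < 1 - x by rewrite subr_gt0.
rewrite -(ler_pM2l y0) divff ?gt_eqF// -[1 - x]opprB mulNr -subrX1 opprB.
by rewrite lerBlDr lerDl exprn_ge0.
Qed.

Definition top n (a : {ffun 'I_n -> nat}) (k : 'I_n) : bool :=
  (0 < a k)%N && [forall i : 'I_n, (k < i)%N ==> (a i == 0%N)].

Lemma exists_top n (a : {ffun 'I_n -> nat}) : deg a != 0%N -> exists k, top a k.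
Proof.
move=> da; have [i ai] : exists i, (0 < a i)%N.
  apply/existsP; apply: contraNT da; rewrite negb_exists => /forallP h.
  by rewrite /deg big1// => i _; apply/eqP; have := h i; rewrite lt0n negbK.
case: (@arg_maxnP _ i (fun j => (0 < a j)%N) val ai) => k ak kmax; exists k.
rewrite /top ak; apply/forallP => j; apply/implyP => kj.
by rewrite -leqn0 leqNgt; apply: contraL kj => /kmax; rewrite -leqNgt.
Qed.

(** The shift by 2 keeps the squares 1/(i+2) below 1 already at index 0, so every one-variable
    geometric series converges. *)
Definition hweight (R : rcfType) n (i : 'I_n) : R := (Num.sqrt (i.+2)%:R)^-1.

Lemma hweight_ge0 (R : rcfType) n (i : 'I_n) : 0 <= hweight R i.
Proof. by rewrite invr_ge0 sqrtr_ge0. Qed.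

Lemma hweight_sqr (R : rcfType) n (i : 'I_n) : hweight R i ^+ 2 = (i.+2)%:R^-1.
Proof. by rewrite exprVn sqr_sqrtr ?ler0n. Qed.

(* The product of the geometric series telescopes:
   [prod_(i < k) (1 - 1/(i+2))^-1 = k+1], which the factor [h_k^2 / (1 - h_k^2)]
   of the variable of index [k] compensates exactly. *)
Lemma sum_top_hweight_le (R : rcfType) n (s : seq {ffun 'I_n -> nat}) (k : 'I_n) :
  uniq s -> \sum_(a <- s | top a k) (mon a (@hweight R n)) ^+ 2 <= 1.
Proof.
move=> us; rewrite -big_filter; set r := seq.filter _ _.
have ur : uniq r by rewrite filter_uniq.
have [d rd] := exists_deg_bound r.
pose F (i : 'I_n) (b : nat) : R :=
  if (i < k)%N then (i.+2)%:R^-1 ^+ b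
  else if i == k then ((0 < b)%N%:R * (i.+2)%:R^-1 ^+ b) else (b == 0%N)%:R.
have F0 i b : 0 <= F i b.
  by rewrite /F; case: ifP => _; [|case: ifP => _];
    rewrite ?mulr_ge0 ?exprn_ge0 ?invr_ge0 ?ler0n.
have rq a i : a \in r -> (a i < d.+1)%N by move=> /rd; rewrite ltnS; exact/leq_trans/leq_deg.
apply: (@le_trans _ _ (\sum_(a <- r) \prod_i F i (a i))).
  rewrite big_seq [leRHS]big_seq ler_sum// => a.
  rewrite mem_filter => /andP[/andP[ak /forallP ta] _].
  rewrite /mon -prodrXl ler_prod// => i _; rewrite exprn_ge0 ?exprn_ge0 ?hweight_ge0//=.
  rewrite -exprM mulnC exprM hweight_sqr /F -val_eqE; case: ltngtP => // ik.
  - by have := ta i; rewrite ik => /eqP ->; rewrite expr0.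
  - by rewrite (val_inj ik) ak mul1r.
apply: (le_trans (ler_sum_box ur rq F0)).
pose g (i : nat) : R := if (i < k)%N then (i.+2)%:R / (i.+1)%:R
  else if i == k then (i.+1)%:R^-1 else 1.
apply: (@le_trans _ _ (\prod_(i < n) g i)).
  apply: ler_prod => i _; rewrite sumr_ge0//= /F /g.
  have x0 : 0 <= (i.+2)%:R^-1 :> R by rewrite invr_ge0.
  have x1 : (i.+2)%:R^-1 < 1 :> R by rewrite invf_lt1 ?ltr0n ?ltr1n.
  have E : (1 - (i.+2)%:R^-1)^-1 = (i.+2)%:R / (i.+1)%:R :> R.
    by rewrite -[i.+2]addn1 natrD; field; rewrite nat1r natr1 !pnatr_eq0.
  case: ifP => _; first by rewrite -E; exact: geometric_sum_le.
  rewrite -val_eqE; case: ifP => _.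
    rewrite big_ord_recl mul0r add0r.
    apply: (@le_trans _ _ ((i.+2)%:R^-1 * \sum_(j < d) (i.+2)%:R^-1 ^+ j)).
      by rewrite mulr_sumr ler_sum// => j _; rewrite mul1r exprS.
    apply: (le_trans (ler_wpM2l x0 (geometric_sum_le _ x0 x1))).
    by rewrite E mulrA mulVf ?pnatr_eq0// mul1r.
  by rewrite big_ord_recl big1// addr0.
have G m : \prod_(i < m) g i = if (m <= k)%N then (m.+1)%:R else 1.
  elim: m => [|m ih]; first by rewrite big_ord0.
  rewrite big_ord_recr/= ih /g; case: (ltngtP m k) => [mk|mk|->].
  - by rewrite mulrCA divff ?mulr1// pnatr_eq0.
  - by rewrite mulr1.
  - by rewrite divff// pnatr_eq0.
by rewrite G leqNgt ltn_ord.
Qed.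

Section Homogeneous.
Variables (R : rcfType) (n : nat) (s : seq {ffun 'I_n -> nat}) (m : nat).
Variables (c : {ffun 'I_n -> nat} -> R[i]) (M : R).
Local Notation normc := (@Normc.normc R).
Hypothesis us : uniq s.
Hypothesis sm : forall a, a \in s -> deg a = m.
Hypothesis PM : forall w, (forall i, normc (w i) <= 1) ->
  normc (\sum_(a <- s) c a * mon a w) <= M.

Lemma mon_decrM (a : {ffun 'I_n -> nat}) k (x : 'I_n -> R[i]) :
  (a k)%:R * (x k * mon (decr a k) x) = (a k)%:R * mon a x.
Proof.
by have [->|ak] := posnP (a k); [rewrite !mul0r|rewrite -mon_decrK].
Qed.

(** Suitable phases [v] turn the sum of moduli into one derivative at [x], along [x * v]. The points
    x_i + x_i v_i t lie in the polydisc of radius 2, and homogeneity brings them back to radius 1 at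
    the cost 2^m. *)
Lemma euler_sum_le (x : 'I_n -> R[i]) : (forall i, normc (x i) = 1) ->
  \sum_k normc (\sum_(a <- s) (a k)%:R * c a * mon a x) <= 2 ^+ m * M.
Proof.
move=> x1; pose th k := \sum_(a <- s) (a k)%:R * c a * mon a x.
have [v hv] := fin_all_exists (fun k => exists_phase (th k)).
have -> : \sum_k normc (th k) =
    normc (\sum_(a <- s) c a * \sum_k (a k)%:R * (x k * v k) * mon (decr a k) x).
  transitivity (normc (\sum_k v k * th k)).
    under [in RHS]eq_bigr do rewrite (hv _).2.
    by rewrite -rmorph_sum normc_real ger0_norm// sumr_ge0// => k _; exact: normc_ge0.
  congr normc; under eq_bigr do rewrite mulr_sumr.
  rewrite exchange_big; apply: eq_bigr => a _; rewrite mulr_sumr.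
  apply: eq_bigr => k _ /=; have := mon_decrM a k x.
  set u := mon (decr a k) x; set y := mon a x => E.
  transitivity (v k * c a * ((a k)%:R * y)); first by ring.
  by rewrite -E; ring.
apply: directional_derivative_le => t t1.
rewrite (_ : \sum_(a <- s) _ =
    2 ^+ m * \sum_(a <- s) c a * mon a (fun i => (x i + x i * v i * t) / 2)).
  rewrite Normc.normcM normcX normc_nat ler_pM2l ?exprn_gt0//.
  apply: PM => i; rewrite Normc.normcM Normc.normcV normc_nat ler_pdivrMr// mul1r.
  apply: (le_trans (le_normcD _ _)); rewrite !Normc.normcM t1 (hv i).1 x1.
  by rewrite !mulr1.
rewrite mulr_sumr; apply: eq_big_seq => a /sm <-.
rewrite mulrCA -mon_scale; congr (_ * _); apply: eq_bigr => i _.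
by rewrite [2 * _]mulrC mulfVK// pnatr_eq0.
Qed.

(** For fixed k, Cauchy-Schwarz against the weights leaves the l_2 norm of the coefficients a_k c_a.
    Replacing it by an L^1 average allows the sum over k to move inside, where [euler_sum_le]
    handles all k at once at each point of the grid. *)
Lemma homogeneous_hweight_le :
  \sum_k \sum_(a <- s | top a k) normc (c a) * mon a (@hweight R n) <= 2 * 4 ^+ m * M.
Proof.
have [zeta hz] := exists_prim_root R[i] (ltn0Sn (m + m)).
pose d (k : 'I_n) (a : {ffun 'I_n -> nat}) : R[i] := (a k)%:R * c a.
have Q0 : 0 < ((m + m).+1 ^ n)%:R :> R by rewrite ltr0n expn_gt0.
rewrite -(ler_pM2l Q0) mulr_sumr.
apply: (@le_trans _ _ (\sum_k 2 ^+ m.+1 * \sum_(t : {ffun 'I_n -> 'I_(m + m).+1})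
    normc (\sum_(a <- s) d k a * mon a (torus_pt zeta t)))).
  apply: ler_sum => k _.
  have sq (a : {ffun 'I_n -> nat}) i : a \in s -> (a i + a i < (m + m).+1)%N.
    by move=> sa; rewrite ltnS leq_add// -(sm sa) leq_deg.
  have sd (a : {ffun 'I_n -> nat}) : a \in s -> (\sum_i a i <= m)%N.
    by move=> sa; rewrite -(sm sa).
  apply: le_trans (torus_khinchine hz (d k) us sq sd); rewrite ler_pM2l//.
  apply: (@le_trans _ _ (\sum_(a <- s | top a k) normc (d k a) * mon a (@hweight R n))).
    apply: ler_sum => a /andP[ak _]; apply: ler_wpM2r.
      by apply: mon_ge0 => i; exact: hweight_ge0.
    by rewrite Normc.normcM normc_nat ler_peMl ?normc_ge0// ler1n.
  rewrite -big_filter.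
  apply: (le_trans (@cauchy_schwarz_seq _ _ _ _ _ 1 _ _ _ _)) => //.
  - by move=> a; exact: normc_ge0.
  - by move=> a; apply: mon_ge0 => i; exact: hweight_ge0.
  - by rewrite expr1n big_filter; exact: sum_top_hweight_le.
  rewrite mulr1 ler_wsqrtr// big_filter big_mkcond/=.
  by apply: ler_sum => a _; case: ifP => // _; rewrite sqr_ge0.
rewrite -mulr_sumr exchange_big/=.
apply: (@le_trans _ _ (2 ^+ m.+1 * \sum_(t : {ffun 'I_n -> 'I_(m + m).+1}) 2 ^+ m * M)).
  rewrite ler_pM2l ?exprn_gt0// ler_sum// => t _; apply: euler_sum_le => i.
  exact: normc_torus_pt.
have E : 4 ^+ m = 2 ^+ m * 2 ^+ m :> R by rewrite -exprMn; congr (_ ^+ m); ring.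
rewrite sumr_const card_ffun !card_ord E exprS -(mulr_natr (2 ^+ m * M)).
by rewrite le_eqVlt; apply/orP; left; apply/eqP; ring.
Qed.

End Homogeneous.

Section SquareRootWeight.
Variables (R : rcfType) (n : nat) (D : ('I_n -> R) -> Prop).
Variables (c : {ffun 'I_n -> nat} -> R[i]) (M : R).
Hypothesis hc : coef_controlled D c M.
Local Notation normc := (@Normc.normc R).

(** The expansion rescaled by [rho] is split by degree. Degree 0 contributes at most M; degree m > 0
    contributes 8^(-m) times 2 * 4^m * M, and these add up to at most 4 M. *)
Lemma controlled_hweight rho (s : seq {ffun 'I_n -> nat}) :
  D rho -> (forall i, 0 <= rho i) -> 0 <= M -> uniq s ->
  \sum_(a <- s) normc (c a) * mon a (fun i => rho i * (hweight R i / 8)) <= 5 * M.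
Proof.
move=> Drho rho0 M0 us; have [s' [us' ss' PM]] := hc Drho s.
have [d sd] := exists_deg_bound s'.
pose e a : R[i] := c a * ((mon a rho)%:C)%C.
pose f a := normc (c a) * mon a (fun i => rho i * (hweight R i / 8)).
have h0 i : 0 <= hweight R i / 8 :> R by rewrite divr_ge0 ?hweight_ge0.
have f0 a : 0 <= f a.
  by rewrite mulr_ge0 ?normc_ge0 ?mon_ge0// => i; rewrite mulr_ge0.
have fE a : f a = (8^-1 ^+ deg a) * (normc (e a) * mon a (@hweight R n)).
  rewrite /f /e Normc.normcM normc_real ger0_norm ?mon_ge0//.
  have -> : mon a (fun i => rho i * (hweight R i / 8)) =
     mon a rho * (8^-1 ^+ deg a * mon a (@hweight R n)).
    by rewrite monM -mon_scale; congr (_ * _); apply: eq_bigr => i _; rewrite mulrC.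
  by ring.
have eM w : (forall i, normc (w i) <= 1) -> normc (\sum_(a <- s') e a * mon a w) <= M.
  move=> w1; have := PM (fun i => ((rho i)%:C)%C * w i).
  rewrite (eq_bigr (fun a => e a * mon a w)) => [|a _]; last first.
    rewrite monM mulrA; congr (_ * _ * _); rewrite /mon rmorph_prod.
    by apply: eq_bigr => i _; rewrite rmorphXn.
  apply => i; rewrite Normc.normcM normc_real ger0_norm//.
  by rewrite ler_piMr.
pose B m : R := if m is 0%N then M else 2 * 2^-1 ^+ m * M.
have step m : \sum_(a <- s' | deg a == m) f a <= B m.
  case: m => [|m].
    have z0 a : deg a == 0%N -> a = [ffun=> 0%N].
      move=> /eqP da; apply/ffunP => i; rewrite ffunE; apply/eqP.
      by rewrite -leqn0 -da leq_deg.
    have fM : f [ffun=> 0%N] <= M.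
      have := controlled_cauchy hc [ffun=> 0%N] Drho rho0 M0.
      by rewrite /f /mon !big1 ?mulr1// => i _; rewrite ffunE expr0.
    rewrite -big_filter.
    have : {subset seq.filter (fun a => deg a == 0%N) s' <= [:: [ffun=> 0%N]]}.
      by move=> a; rewrite mem_filter inE => /andP[/z0 -> _].
    move=> /(ler_sum_subset (filter_uniq _ us')) -/(_ _ _ f0).
    by rewrite big_seq1 => /le_trans; apply.
  rewrite -big_filter; set sm := seq.filter _ _.
  have usm : uniq sm by rewrite filter_uniq.
  have dsm a : a \in sm -> deg a = m.+1 by rewrite mem_filter => /andP[/eqP].
  have esm w : (forall i, normc (w i) <= 1) -> normc (\sum_(a <- sm) e a * mon a w) <= M.
    move=> w1; rewrite big_filter; apply: homogeneous_part_le => t t1.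
    by apply: eM => i; rewrite Normc.normcM t1 mul1r.
  have := homogeneous_hweight_le usm dsm esm.
  rewrite -(ler_pM2l (x := 8^-1 ^+ m.+1)) ?exprn_gt0 ?invr_gt0// => h.
  apply: (le_trans _ (le_trans h _)).
    rewrite (exchange_big_dep xpredT)//= mulr_sumr big_seq [leRHS]big_seq.
    rewrite ler_sum// => a sa; have [k tk] : exists k, top a k.
      by apply: exists_top; rewrite dsm.
    rewrite fE dsm// ler_wpM2l ?exprn_ge0 ?invr_ge0//.
    rewrite (bigD1 k)//= lerDl sumr_ge0// => i _.
    by rewrite mulr_ge0 ?normc_ge0 ?mon_ge0// => j; exact: hweight_ge0.
  rewrite mulrA mulrCA -exprMn (_ : 8^-1 * 4 = 2^-1 :> R); last by field.
  by [].
apply: (@le_trans _ _ (\sum_(a <- s') f a)); first exact: ler_sum_subset.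
rewrite (_ : \sum_(a <- s') f a = \sum_(m < d.+1) \sum_(a <- s' | deg a == m) f a); last first.
  rewrite (exchange_big_dep xpredT)//=; apply: eq_big_seq => a sa.
  rewrite (bigD1 (Ordinal (sd a sa : deg a < d.+1)%N))//= big1 ?addr0// => i /andP[/eqP ai].
  by move=> /eqP[]; apply: val_inj.
apply: (@le_trans _ _ (\sum_(m < d.+1) B m)); first by apply: ler_sum => m _.
rewrite big_ord_recl /= (_ : 5 * M = M + 4 * M) ?lerD2l; last by ring.
apply: (@le_trans _ _ (2 * M * \sum_(m < d) 2^-1 ^+ m)).
  rewrite mulr_sumr ler_sum// => m _; rewrite mulrAC ler_wpM2l ?mulr_ge0//.
  rewrite /bump/= exprS; have : 0 <= 2^-1 ^+ m :> R by rewrite exprn_ge0 ?invr_ge0.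
  lra.
have : \sum_(m < d) 2^-1 ^+ m <= (1 - 2^-1)^-1 :> R by apply: geometric_sum_le; lra.
rewrite (_ : (1 - 2^-1)^-1 = 2 :> R); last by field.
move=> h; rewrite (_ : 4 * M = 2 * M * 2); last by ring.
by rewrite ler_wpM2l// mulr_ge0.
Qed.

End SquareRootWeight.

(** * Weights for the tail variables *)

Lemma exp_sum_le (R : realType) (x : R) q : 0 <= x ->
  \sum_(b < q) x ^+ b / (b`!)%:R <= expR x.
Proof.
move=> x0; have := @nondecreasing_cvgn_le R (series (exp_coeff x)) _
  (is_cvg_series_exp_coeff x) q.
rewrite /series/= big_mkord; apply.
by apply/nondecreasing_seqP => m; rewrite big_nat_recr//= lerDl exp_coeff_ge0.
Qed.

Lemma fact_le_expn b : (b`! <= b ^ b)%N.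
Proof.
elim: b => // b ih; rewrite factS expnS leq_mul2l /=.
apply: (leq_trans ih); case: b {ih} => // b.
by rewrite leq_exp2r.
Qed.

Lemma prod_lt_const (R : comPzSemiRingType) n N (x : R) :
  \prod_(i < n) (if (i < N)%N then x else 1) = x ^+ minn n N.
Proof.
elim: n => [|n ih]; first by rewrite big_ord0 min0n.
rewrite big_ord_recr /= ih; case: ltnP => nN.
  by rewrite -exprSr; congr (_ ^+ _); lia.
by rewrite mulr1; congr (_ ^+ _); lia.
Qed.

Section BlockWeights.
Variables (R : realType) (n N : nat) (kappa V eta : R) (v : 'I_n -> R).
Hypotheses (kappa0 : 0 <= kappa) (kappa1 : kappa < 1) (V0 : 0 < V) (eta0 : 0 < eta).
Hypothesis v0 : forall i, 0 <= v i.
Hypothesis vV : \sum_(i < n | (N <= i)%N) v i <= V.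
Hypothesis Veta : expR 1 * V / eta <= 2^-1.

Definition tail_deg (a : {ffun 'I_n -> nat}) : nat := (\sum_(i < n | (N <= i)%N) a i)%N.

(** This dominates the quotient of z^a by the a-th power of [adapted_radius]: a tail variable gives
    (m v_i / (eta a_i))^(a_i) with m the tail degree, and a_i^(a_i) >= a_i!. *)
Definition tail_weight (a : {ffun 'I_n -> nat}) : R :=
  \prod_(i < n) (if (i < N)%N then kappa ^+ a i
           else ((tail_deg a)%:R * v i / eta) ^+ a i / (a i)`!%:R).

Lemma tail_weight_ge0 a : 0 <= tail_weight a.
Proof.
apply: prodr_ge0 => i _; case: ifP => _; first exact: exprn_ge0.
by rewrite divr_ge0// exprn_ge0// divr_ge0 ?mulr_ge0// ltW.
Qed.

(* At fixed tail degree [m], comparing with the exponential series at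
   [m * v_i / V] replaces the multinomial theorem. *)
Lemma sum_tail_weight_deg_le s m : uniq s ->
  \sum_(a <- s | tail_deg a == m) tail_weight a <= ((1 - kappa)^-1) ^+ N * 2^-1 ^+ m.
Proof.
move=> us; rewrite -big_filter; set r := seq.filter _ _.
have ur : uniq r by rewrite filter_uniq.
have rm a : a \in r -> tail_deg a = m by rewrite mem_filter => /andP[/eqP].
have [d rd] := exists_deg_bound r.
have rq a i : a \in r -> (a i < d.+1)%N by move=> /rd; rewrite ltnS; exact/leq_trans/leq_deg.
pose F (i : 'I_n) (b : nat) : R := if (i < N)%N then kappa ^+ b
  else (m%:R * v i / V) ^+ b / b`!%:R.
have mv0 i : 0 <= m%:R * v i / V by rewrite divr_ge0 ?mulr_ge0// ltW.
have F0 i b : 0 <= F i b.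
  by rewrite /F; case: ifP => _; rewrite ?divr_ge0 ?exprn_ge0.
have E a : a \in r -> tail_weight a = (V / eta) ^+ m * \prod_i F i (a i).
  move=> ar.
  have -> : (V / eta) ^+ m = \prod_(i < n) (if (i < N)%N then 1 else (V / eta) ^+ a i).
    rewrite -(rm a ar) /tail_deg -prodrXr big_mkcond; apply: eq_bigr => i _.
    by rewrite leqNgt; case: (i < N)%N.
  rewrite -big_split; apply: eq_bigr => i _ /=; rewrite /F (rm a ar); case: ifP => _ /=.
    by rewrite mul1r.
  rewrite mulrA -exprMn; congr (_ ^+ _ / _); field.
  by rewrite !gt_eqF.
rewrite (eq_big_seq _ E) -mulr_sumr.
have Ve0 : 0 <= V / eta by rewrite divr_ge0// ltW.
have k1 : 1 <= (1 - kappa)^-1 by rewrite invf_ge1 ?subr_gt0// gerBl.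
apply: (@le_trans _ _ ((V / eta) ^+ m * (((1 - kappa)^-1) ^+ N * expR 1 ^+ m))); last first.
  rewrite mulrCA ler_wpM2l ?exprn_ge0 ?(le_trans _ k1)// -exprMn.
  apply: lerXn2r; rewrite ?nnegrE ?invr_ge0//; first by rewrite mulr_ge0 ?expR_ge0.
  by rewrite mulrC mulrA.
apply: ler_wpM2l; first exact: exprn_ge0.
apply: (le_trans (ler_sum_box ur rq F0)).
apply: (@le_trans _ _ (\prod_(i < n) ((if (i < N)%N then (1 - kappa)^-1 else 1) *
    (if (N <= i)%N then expR (m%:R * v i / V) else 1)))).
  apply: ler_prod => i _; rewrite sumr_ge0//= /F; case: ltnP => _.
    by rewrite mulr1; exact: geometric_sum_le.
  by rewrite mul1r; exact: exp_sum_le.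
rewrite big_split/= prod_lt_const -big_mkcond/=.
rewrite ler_pM ?exprn_ge0 ?(le_trans _ k1)//.
- by apply: prodr_ge0 => i _; exact: expR_ge0.
- by apply: ler_weXn2l; rewrite ?geq_minr.
rewrite -expR_sum -expRM_natl mulr1 ler_expR -mulr_suml -mulr_sumr.
by rewrite ler_pdivrMr// ler_wpM2l.
Qed.

Lemma sum_tail_weight_le s : uniq s ->
  \sum_(a <- s) tail_weight a <= 2 * ((1 - kappa)^-1) ^+ N.
Proof.
move=> us; have [d sd] := exists_deg_bound s.
have td a : (tail_deg a <= deg a)%N.
  by rewrite /deg (bigID (fun i : 'I_n => N <= i)%N)/= leq_addr.
rewrite (_ : \sum_(a <- s) _ = \sum_(m < d.+1) \sum_(a <- s | tail_deg a == m) tail_weight a);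
    last first.
  rewrite (exchange_big_dep xpredT)//=; apply: eq_big_seq => a sa.
  have ad : (tail_deg a < d.+1)%N by rewrite ltnS (leq_trans (td a))// sd.
  rewrite (bigD1 (Ordinal ad))//= big1 ?addr0// => i /andP[/eqP ai].
  by move=> /eqP[]; apply: val_inj.
apply: (@le_trans _ _ (\sum_(m < d.+1) ((1 - kappa)^-1) ^+ N * 2^-1 ^+ m)).
  by apply: ler_sum => m _; exact: sum_tail_weight_deg_le.
rewrite -mulr_sumr mulrC ler_wpM2r//.
  by rewrite exprn_ge0// invr_ge0 subr_ge0 ltW.
apply: (le_trans (geometric_sum_le _ _ _)); [lra|lra|].
by rewrite (_ : 1 - 2^-1 = 2^-1 :> R) ?invrK//; lra.
Qed.

(** On the tail this radius maximises the monomial among radii of l_1 norm [eta]. At tail degree 0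
    the division yields 0, which is harmless since no tail variable occurs in [a]. *)
Definition adapted_radius (rho : 'I_n -> R) (a : {ffun 'I_n -> nat}) (i : 'I_n) : R :=
  if (i < N)%N then rho i else eta * (a i)%:R / (tail_deg a)%:R.

Lemma mon_le_tail_weight (rho z : 'I_n -> R) (a : {ffun 'I_n -> nat}) :
  (forall i, 0 <= z i) -> (forall i : 'I_n, (i < N)%N -> z i <= kappa * rho i) ->
  (forall i : 'I_n, (N <= i)%N -> (0 < a i)%N -> z i <= v i) ->
  mon a z <= tail_weight a * mon a (adapted_radius rho a).
Proof.
move=> z0 zrho zv; rewrite /mon -big_split; apply: ler_prod => i _ /=.
rewrite exprn_ge0//= /adapted_radius; case: ltnP => iN.
  rewrite -exprMn; apply: lerXn2r; rewrite ?nnegrE ?z0 ?zrho//.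
  exact: le_trans (z0 i) (zrho i iN).
have [->|ai] := posnP (a i); first by rewrite !expr0 fact0 divr1 mulr1.
have m0 : (0 < tail_deg a)%N by rewrite /tail_deg (bigD1 i)//= addn_gt0 ai.
rewrite mulrAC -exprMn ler_pdivlMr ?ltr0n ?fact_gt0//.
rewrite (_ : _ * v i / eta * _ = v i * (a i)%:R); last first.
  by field; rewrite pnatr_eq0 -lt0n m0 gt_eqF.
rewrite exprMn ler_pM ?exprn_ge0//.
  by rewrite lerXn2r ?nnegrE ?z0 ?v0 ?zv.
by rewrite -natrX ler_nat fact_le_expn.
Qed.

End BlockWeights.

(** * Sequence spaces and unconditional sums *)

Lemma nneseries_le_bound (R : realType) (x : nat -> R) (B : R) :
  (forall k, 0 <= x k) -> (forall n, \sum_(k < n) x k <= B) ->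
  (\sum_(k <oo) (x k)%:E <= B%:E)%E.
Proof.
move=> x0 xB; apply: lime_le; first by apply: is_cvg_nneseries => k _ _; rewrite lee_fin.
by apply: nearW => n; rewrite sumEFin lee_fin big_mkord.
Qed.

Lemma partial_sum_le_nneseries (R : realType) (x : nat -> R) n :
  (forall k, 0 <= x k) -> ((\sum_(k < n) x k)%:E <= \sum_(k <oo) (x k)%:E)%E.
Proof.
move=> x0; rewrite -(big_mkord xpredT) -sumEFin.
by apply: nneseries_lim_ge => k _ _; rewrite lee_fin.
Qed.

Section EllInterface.
Variables (R : realType).
Local Notation normc := (@Normc.normc R).

Lemma ellp_bound (p : R) (x : nat -> Cplx R) : 0 < p ->
  x \in ellp p <-> exists B : R, forall n, \sum_(k < n) normc (x k) `^ p <= B.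
Proof.
move=> p0; split => [/(ellpE _ p0) h|[B xB]].
  exists (fine (\sum_(k <oo) (normc (x k) `^ p)%:E)) => n; rewrite -lee_fin fineK.
    by apply: (@partial_sum_le_nneseries R (fun k => normc (x k) `^ p)) => k; exact: powR_ge0.
  rewrite ge0_fin_numE//; apply: nneseries_ge0 => k _ _.
  by rewrite lee_fin powR_ge0.
apply/(ellpE _ p0); apply: le_lt_trans (ltry B).
apply: (@nneseries_le_bound R (fun k => normc (x k) `^ p)) => // k; exact: powR_ge0.
Qed.

Variables (r : R) (r1 : 1 <= r).
Let r0 : 0 < r. Proof. exact: lt_le_trans r1. Qed.
Let powr1 : 1 `^ r = 1. Proof. by rewrite powR1. Qed.

Lemma ell_normE_series (z : ell r1) :
  (\sum_(k <oo) (normc (z k) `^ r)%:E)%E = (ell_norm z `^ r)%:E.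
Proof.
have zr : (\sum_(k <oo) (normc (z k) `^ r)%:E < +oo)%E.
  by apply/(ellpE _ r0); exact: ell_valP.
have s0 : (0 <= \sum_(k <oo) (normc (z k) `^ r)%:E)%E.
  by apply: nneseries_ge0 => k _ _; rewrite lee_fin powR_ge0.
have := ell_normE z; rewrite /ell_enorm Lnorm_counting//.
rewrite (_ : (\sum_(k <oo) _ = \sum_(k <oo) (normc (z k) `^ r)%:E)%E); last first.
  by apply: eq_eseriesr => k _ /=; rewrite ger0_norm// modulus_ge0.
have sE : (\sum_(k <oo) (normc (z k) `^ r)%:E)%E =
    (fine (\sum_(k <oo) (normc (z k) `^ r)%:E))%:E.
  by rewrite fineK// ge0_fin_numE.
rewrite sE; set t := fine _; have t0 : 0 <= t by rewrite -lee_fin -sE.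
rewrite poweR_EFin => -[->]; rewrite -powRrM mulVf ?gt_eqF// powRr1//.
Qed.

Lemma ell_norm_ge0 (z : ell r1) : 0 <= ell_norm z.
Proof. by rewrite -lee_fin ell_normE; exact: ell_enorm_ge0. Qed.

Lemma unit_ball_bound (z : ell r1) : unit_ball r1 z ->
  exists2 sigma : R, sigma < 1 & forall n, \sum_(k < n) normc (z k) `^ r <= sigma.
Proof.
move=> /unit_ballE z1; exists (ell_norm z `^ r).
  rewrite -[ltRHS]powr1; apply: gt0_ltr_powR => //; rewrite ?nnegrE//.
  exact: ell_norm_ge0.
move=> n; rewrite -lee_fin -ell_normE_series.
by apply: (@partial_sum_le_nneseries R (fun k => normc (z k) `^ r)) => k; exact: powR_ge0.
Qed.

Lemma exists_ell (x : nat -> Cplx R) (sigma : R) : sigma < 1 ->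
  (forall n, \sum_(k < n) normc (x k) `^ r <= sigma) ->
  exists2 z : ell r1, (z : nat -> Cplx R) = x & unit_ball r1 z.
Proof.
move=> s1 xs; have xr : x \in ellp r by apply/(ellp_bound _ r0); exists sigma.
exists (Ell r1 xr) => //; apply/unit_ballE; rewrite ltNge; apply/negP => z1.
have : (\sum_(k <oo) (normc (Ell r1 xr k) `^ r)%:E <= sigma%:E)%E.
  by apply: (@nneseries_le_bound R (fun k => normc (x k) `^ r)) => // k; exact: powR_ge0.
rewrite ell_normE_series lee_fin leNgt => /negP; apply.
apply: (lt_le_trans s1); rewrite -[leLHS]powr1.
by apply: ge0_ler_powR; rewrite ?nnegrE ?ell_norm_ge0// ltW.
Qed.

End EllInterface.

Lemma big_fsetU_disjoint (T : choiceType) (V : zmodType) (A B : {fset T}) (F : T -> V) :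
  [disjoint A & B]%fset ->
  \sum_(t <- (A `|` B)%fset) F t = \sum_(t <- A) F t + \sum_(t <- B) F t.
Proof.
move=> /fdisjointP AB; rewrite -big_cat; apply: perm_big; apply: uniq_perm => //.
- by rewrite cat_uniq !fset_uniq andbT; apply/hasPn => t tB; apply/negP => /AB; rewrite tB.
- by move=> t; rewrite mem_cat inE.
Qed.

(** * Unconditional convergence implies absolute convergence *)

Section UnconditionalSums.
Variables (R : realType) (T : choiceType) (x : T -> Cplx R) (l : Cplx R).
Local Notation normc := (@Normc.normc R).
Local Open Scope fset_scope.
Local Open Scope ring_scope.
Hypothesis xl : summability.partial_sum x @ summability.totally --> l.

Lemma total_cvg_near (e : R) : 0 < e ->
  exists A : {fset T}, forall B : {fset T}, (A `<=` B)%fset ->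
    normc (\sum_(t <- B) x t - l) < e.
Proof.
move=> e0; have FF : ProperFilter (@summability.totally T) := summability.totally_filter.
have /cvgrPdist_lt /(_ (e%:C)%C) := xl.
rewrite ltcR => /(_ e0) [A _ AE]; exists A => B AB.
have := AE B AB; rewrite /= -ltcR -normr_complex distrC /summability.partial_sum.
by rewrite big_seq_fsetE.
Qed.

Lemma normc_le_Re_Im (z : R[i]) : normc z <= `|complex.Re z| + `|complex.Im z|.
Proof.
case: z => a b /=; rewrite -[leRHS]ger0_norm ?addr_ge0// -sqrtr_sqr ler_wsqrtr//.
rewrite -[a ^+ 2]real_normK ?num_real// -[b ^+ 2]real_normK ?num_real//.
have := mulr_ge0 (normr_ge0 a) (normr_ge0 b); lra.
Qed.

Lemma normc_ge_Re_Im (z : R[i]) : `|complex.Re z| <= normc z /\ `|complex.Im z| <= normc z.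
Proof.
by case: z => a b /=; split; rewrite -sqrtr_sqr ler_wsqrtr// ?lerDl ?lerDr sqr_ge0.
Qed.

(** Every subset of a finite set disjoint from [A] has a sum of modulus at most e/4. Splitting real
    and imaginary parts by sign gives four such subsets. *)
Lemma total_cvg_abs_small (e : R) : 0 < e ->
  exists A : {fset T}, forall B : {fset T}, [disjoint A & B]%fset ->
    \sum_(t <- B) normc (x t) <= e.
Proof.
move=> e0; have e8 : 0 < e / 8 by rewrite divr_gt0.
have [A AE] := total_cvg_near e8; exists A => B AB.
have small (B' : {fset T}) : (B' `<=` B)%fset -> normc (\sum_(t <- B') x t) <= e / 4.
  move=> B'B; have AB' : [disjoint A & B']%fset by apply: fdisjointWr AB.
  rewrite (_ : \sum_(t <- B') x t =
      (\sum_(t <- (A `|` B')%fset) x t - l) - (\sum_(t <- A) x t - l)).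
    apply: (le_trans (le_normcD _ _)); rewrite normcN.
    have := AE _ (fsubset_refl A); have := AE _ (fsubsetUl A B'); lra.
  by rewrite big_fsetU_disjoint//; set u := bigop _ _ _; set v := bigop _ _ _; ring.
have key (g : R[i] -> R) : (forall z, `|g z| <= normc z) ->
    {morph g : u v / u + v} -> g 0 = 0 -> \sum_(t <- B) `|g (x t)| <= e / 2.
  move=> gn gD g0; have gs (B' : {fset T}) : (B' `<=` B)%fset ->
      `|\sum_(t <- B') g (x t)| <= e / 4.
    move=> B'B; rewrite -(big_morph _ gD g0); apply: (le_trans (gn _)); exact: small.
  rewrite (bigID (fun t => 0 <= g (x t)))/=.
  pose P := [fset t in B | 0 <= g (x t)]%fset.
  pose N := [fset t in B | ~~ (0 <= g (x t))]%fset.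
  have PB : (P `<=` B)%fset by apply/fsubsetP => t; rewrite !inE/= => /andP[].
  have NB : (N `<=` B)%fset by apply/fsubsetP => t; rewrite !inE/= => /andP[].
  have -> : \sum_(t <- B | 0 <= g (x t)) `|g (x t)| = \sum_(t <- P) g (x t).
    by rewrite big_fset/=; apply: eq_bigr => t t0; rewrite ger0_norm.
  have -> : \sum_(t <- B | ~~ (0 <= g (x t))) `|g (x t)| = - \sum_(t <- N) g (x t).
    by rewrite big_fset/= -sumrN; apply: eq_bigr => t; rewrite -ltNge => /ltr0_norm.
  have := ler_norm (\sum_(t <- P) g (x t)); have := gs _ PB.
  have := ler_norm (- \sum_(t <- N) g (x t)); rewrite normrN; have := gs _ NB.
  lra.
have kR := key (@complex.Re R) (fun z => (normc_ge_Re_Im z).1).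
have kI := key (@complex.Im R) (fun z => (normc_ge_Re_Im z).2).
apply: (@le_trans _ _ (\sum_(t <- B) (`|complex.Re (x t)| + `|complex.Im (x t)|))).
  by apply: ler_sum => t _; exact: normc_le_Re_Im.
rewrite big_split/= [e]splitr lerD//; first by apply: kR => // -[? ?] [].
by apply: kI => // -[? ?] [].
Qed.

End UnconditionalSums.

(** * From holomorphic functions to their coefficients *)

Section MultiIndices.
Variable n : nat.

Definition extend (T : Type) (x0 : T) (w : 'I_n -> T) (k : nat) : T :=
  if insub k is Some i then w i else x0.

Lemma extend_ord (T : Type) (x0 : T) (w : 'I_n -> T) (i : 'I_n) : extend x0 w i = w i.
Proof. by rewrite /extend valK. Qed.

Lemma extend_ge (T : Type) (x0 : T) (w : 'I_n -> T) k : (n <= k)%N -> extend x0 w k = x0.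
Proof. by move=> nk; rewrite /extend insubN// -leqNgt. Qed.

Definition to_multi_index (a : {ffun 'I_n -> nat}) : multi_index :=
  [fsfun k in [fset k in iota 0 n]%fset => extend 0%N a k | 0%N].

Definition of_multi_index (alpha : multi_index) : {ffun 'I_n -> nat} :=
  [ffun i => alpha (val i)].

Definition supported (alpha : multi_index) : bool := all (ltn^~ n) (finsupp alpha).

Lemma to_multi_indexE a k : to_multi_index a k = extend 0%N a k.
Proof.
rewrite /to_multi_index fsfunE !inE mem_iota leq0n add0n /=.
by case: ltnP => // nk; rewrite extend_ge.
Qed.

Lemma of_multi_indexK alpha : supported alpha -> to_multi_index (of_multi_index alpha) = alpha.
Proof.
move=> /allP sa; apply/fsfunP => k; rewrite to_multi_indexE.
case: (ltnP k n) => kn; first by rewrite -[k]/(val (Ordinal kn)) extend_ord ffunE.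
rewrite extend_ge//; apply/esym/eqP; rewrite -memNfinsupp; apply/negP => /sa /=.
by rewrite ltnNge kn.
Qed.

Lemma to_multi_indexK : cancel to_multi_index of_multi_index.
Proof. by move=> a; apply/ffunP => i; rewrite ffunE to_multi_indexE extend_ord. Qed.

Lemma supported_to_multi_index a : supported (to_multi_index a).
Proof.
apply/allP => k; rewrite mem_finsupp to_multi_indexE => h.
by rewrite /= ltnNge; apply: contra_neqN h => nk; rewrite extend_ge.
Qed.

Lemma monomial_supported (R : realType) alpha (z : nat -> Cplx R) : supported alpha ->
  monomial alpha z = mon (of_multi_index alpha) (fun i => z (val i) : R[i]).
Proof.
move=> /allP sa; rewrite /monomial /mon.
transitivity (\prod_(k <- iota 0 n | k \in finsupp alpha) z k ^+ alpha k).
  rewrite -[RHS]big_filter; apply: perm_big; apply: uniq_perm;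
    rewrite ?filter_uniq ?iota_uniq//.
  move=> k; rewrite mem_filter mem_iota add0n /=.
  by case: (boolP (k \in finsupp alpha)) => //= /sa /= ->.
rewrite big_mkcond -{1}[n]subn0 big_mkord; apply: eq_bigr => i _.
by rewrite mem_finsupp ffunE; case: eqP => //= ->; rewrite expr0.
Qed.

Lemma monomial_unsupported (R : realType) alpha (z : nat -> Cplx R) : ~~ supported alpha ->
  (forall k, (n <= k)%N -> z k = 0) -> monomial alpha z = 0.
Proof.
rewrite -has_predC => /hasP[k ka /=]; rewrite -leqNgt => nk z0.
rewrite /monomial (big_rem k)/=; last exact: ka.
rewrite (z0 k nk) expr0n; move: ka; rewrite mem_finsupp => /negbTE ->.
by rewrite mul0r.
Qed.

End MultiIndices.

Definition ell_radius (R : realType) (r : R) n (rho : 'I_n -> R) : Prop :=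
  (forall i, 0 <= rho i) /\ \sum_i rho i `^ r < 1.

Section Transfer.
Variables (R : realType) (r : R) (r1 : 1 <= r).
Local Notation normc := (@Normc.normc R).
Let r0 : 0 < r. Proof. exact: lt_le_trans r1. Qed.

Lemma sum_extend_le n (g : 'I_n -> R) m : (forall i, 0 <= g i) ->
  \sum_(k < m) extend 0 g k <= \sum_i g i.
Proof.
move=> g0; have e0 k : 0 <= extend 0 g k.
  by case: (ltnP k n) => kn; [rewrite -[k]/(val (Ordinal kn)) extend_ord|rewrite extend_ge].
have -> : \sum_i g i = \sum_(k < n) extend 0 g k.
  by apply: eq_bigr => i _; rewrite extend_ord.
rewrite -!(big_mkord xpredT); case: (leqP m n) => mn.
  by rewrite [leRHS](@big_cat_nat _ _ _ m)//= lerDl sumr_ge0.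
have nm := ltnW mn.
rewrite (@big_cat_nat _ _ _ n)//=.
have -> : \sum_(n <= k < m) extend 0 g k = 0.
  rewrite big_nat_cond; apply: big1 => k.
  by rewrite andbT => /andP[nk _]; rewrite extend_ge.
by rewrite addr0.
Qed.

Variables (f : ell r1 -> Cplx R) (M : R) (c : multi_index -> Cplx R).
Hypothesis fM : forall z, unit_ball r1 z -> normc (f z) <= M.
Hypothesis fc : monomial_expansion f c.

Lemma exists_finite_pt n (rho : 'I_n -> R) (w : 'I_n -> R[i]) : ell_radius r rho ->
  (forall i, normc (w i) <= rho i) ->
  exists z : ell r1, [/\ (z : nat -> Cplx R) = extend 0 w, unit_ball r1 z &
    summability.partial_sum (fun a => c a * monomial a z) @ summability.totally --> f z].
Proof.
move=> [rho0 rho1] wrho; have [z zE uz] : exists2 z : ell r1,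
    (z : nat -> Cplx R) = extend 0 w & unit_ball r1 z.
  apply: (exists_ell _ rho1) => m.
  apply: (le_trans _ (sum_extend_le m (fun i => powR_ge0 (rho i) r))).
  apply: ler_sum => k _; case: (ltnP k n) => kn; last first.
    by rewrite !extend_ge// Normc.normc0 powR0 ?gt_eqF.
  rewrite -[val k]/(val (Ordinal kn)) !extend_ord.
  by apply: ge0_ler_powR; rewrite ?nnegrE ?normc_ge0// ltW.
exists z; split => //; apply: fc => //.
apply: sub_finite_set (finite_II n) => k /=; rewrite zE => h.
by rewrite ltnNge; apply: contra_neqN h => nk; rewrite extend_ge.
Qed.

(** The finite set [A] is chosen at the single point [rho], so that the terms outside it have
    absolute sum at most 1/2 there. Every w with |w_i| <= rho_i inherits this bound termwise, so one
    set [S] works for all w; the added 1 is this 1/2 plus the 1/2 lost in approximating f by a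
    finite sum. *)
Lemma expansion_controlled n :
  coef_controlled (@ell_radius R r n) (fun a => c (to_multi_index a)) (M + 1).
Proof.
move=> rho Drho s; have [rho0 _] := Drho.
pose rhoC i : R[i] := ((rho i)%:C)%C.
have nrho i : normc (rhoC i) = rho i by rewrite normc_real ger0_norm.
have half0 : 0 < 2^-1 :> R by rewrite invr_gt0.
have [zr [zrE _ zrc]] : exists z : ell r1,
    [/\ (z : nat -> Cplx R) = extend 0 rhoC, unit_ball r1 z &
    summability.partial_sum (fun a => c a * monomial a z) @ summability.totally --> f z].
  by apply: (exists_finite_pt Drho) => i; rewrite nrho.
have [A AE] := total_cvg_abs_small zrc half0.
pose S := (A `|` [fset to_multi_index a | a in s])%fset.
pose s' := [seq of_multi_index n alpha | alpha <- S & supported n alpha].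
exists s'; split.
- rewrite map_inj_in_uniq ?filter_uniq ?fset_uniq// => alpha beta.
  rewrite !mem_filter => /andP[sa _] /andP[sb _] E.
  by rewrite -(of_multi_indexK sa) -(of_multi_indexK sb) E.
- move=> a sa; apply/mapP; exists (to_multi_index a); last by rewrite to_multi_indexK.
  rewrite mem_filter supported_to_multi_index/= !inE; apply/orP; right.
  by apply/imfsetP; exists a.
move=> w wrho; have [z [zE uz zc]] := exists_finite_pt Drho wrho.
have z0 k : (n <= k)%N -> z k = 0 by move=> nk; rewrite zE extend_ge.
have -> : \sum_(a <- s') c (to_multi_index a) * mon a w =
    \sum_(alpha <- S) c alpha * monomial alpha z.
  rewrite big_map big_filter big_mkcond; apply: eq_bigr => alpha _.
  case: (boolP (supported n alpha)) => sa; last first.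
    by rewrite (monomial_unsupported sa z0) mulr0.
  rewrite of_multi_indexK// (monomial_supported _ sa); congr (_ * _).
  by apply: eq_bigr => i _; rewrite zE extend_ord.
have [A2 A2E] := total_cvg_near zc half0.
pose B := (A2 `\` S)%fset.
have SB : [disjoint S & B]%fset by apply/fdisjointP => t tS; rewrite inE tS.
have AB : [disjoint A & B]%fset by apply: fdisjointWl SB; exact: fsubsetUl.
have A2SB : (A2 `<=` S `|` B)%fset.
  by apply/fsubsetP => t tA; rewrite in_fsetU in_fsetD tA andbT; case: (t \in S).
have := A2E _ A2SB; rewrite big_fsetU_disjoint// => h.
have hB : normc (\sum_(alpha <- B) c alpha * monomial alpha z) <= 2^-1.
  apply: le_trans (AE B AB); apply: (le_trans (normc_sum _ _ _)).
  apply: ler_sum => alpha _; rewrite !Normc.normcM; apply: ler_wpM2l; first exact: normc_ge0.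
  rewrite /monomial !normc_prod; apply: ler_prod => k _.
  rewrite !normcX exprn_ge0 ?normc_ge0//=.
  apply: lerXn2r; rewrite ?nnegrE ?normc_ge0// zE zrE.
  case: (ltnP k n) => kn; last by rewrite !extend_ge// Normc.normc0.
  by rewrite -[k]/(val (Ordinal kn)) !extend_ord nrho.
set X := \sum_(alpha <- S) _ in h *; set Y := \sum_(alpha <- B) _ in h hB *.
rewrite (_ : X = (X + Y - f z) + (f z - Y)); last by ring.
apply: (le_trans (le_normcD _ _)).
have := le_normcD (f z) (- Y); rewrite normcN; have := fM uz; lra.
Qed.

End Transfer.

Section Criterion.
Variables (R : realType) (r : R) (r1 : 1 <= r).
Local Notation normc := (@Normc.normc R).

Lemma exists_supported (A : {fset multi_index}) :
  exists n, forall alpha, alpha \in A -> supported n alpha.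
Proof.
exists (\max_(alpha <- A) \max_(k <- finsupp alpha) k.+1)%N => alpha aA.
apply/allP => k ka /=.
have h1 := @leq_bigmax_seq _ _ _ (fun alpha : multi_index =>
  \max_(k <- finsupp alpha) k.+1)%N _ aA isT.
have h2 := @leq_bigmax_seq _ _ _ (fun k => k.+1) _ ka isT.
exact: leq_trans h2 h1.
Qed.

(* When no monomial expansion exists the coefficients are the junk value [0], and
   the series converges trivially: existence of the expansion is never needed. *)
Lemma monHooI (z : ell r1) : unit_ball r1 z ->
  (forall M : R, 0 <= M -> exists K : R, forall n (c : {ffun 'I_n -> nat} -> R[i]),
     coef_controlled (@ell_radius R r n) c M -> forall s, uniq s ->
     \sum_(a <- s) normc (c a) * mon a (fun i => normc (z (val i))) <= K) ->
  monHoo r1 z.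
Proof.
move=> uz zK; split => // f [_ [M fM]].
have [[c fc]|noc] := pselect (exists c, monomial_expansion f c); last first.
  rewrite (_ : monomial_coef f = fun=> 0).
    by rewrite esum1// => a _; rewrite mul0r Normc.normc0.
  by rewrite /monomial_coef getPN// => c fc; apply: noc; exists c.
have {c fc} fc : monomial_expansion f (monomial_coef f) by apply: (getPex (ex_intro _ c fc)).
have M1 : 0 <= M + 1.
  have := fM z uz; have := normc_ge0 (f z); lra.
have [K hK] := zK _ M1.
apply: le_lt_trans (ltry K); apply: ub_ereal_sup => _ [A [finA _] <-].
rewrite fsbig_finite//= sumEFin lee_fin.
have [n An] := exists_supported (fset_set A).
have := hK n _ (@expansion_controlled _ _ _ _ _ _ fM fc n)
  [seq of_multi_index n alpha | alpha <- fset_set A].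
rewrite map_inj_in_uniq ?fset_uniq; last first.
  move=> alpha beta aA bA E.
  by rewrite -(of_multi_indexK (An _ aA)) -(of_multi_indexK (An _ bA)) E.
move=> /(_ isT); apply: le_trans; rewrite big_map big_seq [leRHS]big_seq.
apply: ler_sum => alpha aA; rewrite Normc.normcM of_multi_indexK ?An//.
by rewrite (monomial_supported _ (An _ aA)) normc_mon.
Qed.

End Criterion.

(** * The inclusion *)

(** Once N terms come within [e] of the supremum of the partial sums, no later stretch can exceed
    [e]; one [N] thus serves all [n]. *)
Lemma exists_small_tail (R : realType) (x : nat -> R) (B e : R) :
  (forall k, 0 <= x k) -> (forall n, \sum_(k < n) x k <= B) -> 0 < e ->
  exists N, forall n, \sum_(k < n | (N <= k)%N) x k <= e.
Proof.
move=> x0 xB e0; pose S := range (fun n => \sum_(k < n) x k).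
have hS : has_sup S by split; [exists (\sum_(k < 0) x k); exists 0%N|exists B => _ [n _ <-]].
have [_ [N _ <-] hN] := sup_adherent e0 hS; exists N => n.
have Sn : \sum_(k < n) x k <= sup S by apply: sup_upper_bound => //; exists n.
case: (leqP N n) => Nn; last first.
  rewrite big1 ?ltW// => k Nk; exfalso; have := leq_trans Nn Nk.
  by rewrite ltnNge (ltnW (ltn_ord k)).
suff : \sum_(k < n) x k = \sum_(k < N) x k + \sum_(k < n | (N <= k)%N) x k by lra.
rewrite (bigID (fun k : 'I_n => (N <= k)%N))/= addrC; congr (_ + _).
rewrite (big_ord_widen _ x Nn); apply: eq_bigl => k; by rewrite ltnNge.
Qed.

Lemma one_sub_sum_le_prod (R : realFieldType) (I : Type) (s : seq I) (P : pred I) (t : I -> R) :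
  (forall i, P i -> 0 <= t i <= 1) ->
  1 - \sum_(i <- s | P i) t i <= \prod_(i <- s | P i) (1 - t i).
Proof.
move=> t01; elim: s => [|i s ih]; first by rewrite !big_nil subr0.
rewrite !big_cons; case: ifP => // Pi; have /andP[t0 t1] := t01 i Pi.
have p1 : \prod_(j <- s | P j) (1 - t j) <= 1.
  by apply: prodr_ile1 => j /t01; lra.
have := mulr_ge0 t0 (_ : 0 <= 1 - \prod_(j <- s | P j) (1 - t j)).
rewrite subr_ge0 => /(_ p1); move: ih p1.
set p := bigop _ _ _; set q := bigop _ _ _; lra.
Qed.

Lemma powRV (R : realType) (x p : R) : 0 < x -> x^-1 `^ p = (x `^ p)^-1.
Proof.
move=> x0; have y0 : x `^ p != 0 by rewrite gt_eqF ?powR_gt0.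
by apply: (mulIf y0); rewrite -powRM ?invr_ge0 ?ltW// !mulVf ?powR1// gt_eqF.
Qed.

Section Inclusion.
Variables (R : realType) (r : R) (r1 : 1 <= r) (z : ell r1).
Local Notation normc := (@Normc.normc R).
Let r0 : 0 < r. Proof. exact: lt_le_trans r1. Qed.
Let az k : R := normc (z k).
Let az0 k : 0 <= az k. Proof. exact: normc_ge0. Qed.
Hypothesis uz : unit_ball r1 z.

(** The ball is open: dividing by a [kappa] whose r-th power lies midway between the bound for z and
    1 stays in the ball, and the slack 1 - tau is left for the tail variables. *)
Lemma exists_dilation : exists kappa tau : R, [/\ 0 < kappa, kappa < 1, 0 <= tau, tau < 1 &
  forall n, \sum_(k < n) (az k / kappa) `^ r <= tau].
Proof.
have [sg sg1 hsg] := unit_ball_bound uz.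
have sg0 : 0 <= sg by apply: le_trans (hsg 0%N); rewrite big_ord0.
pose sg' := (1 + sg) / 2; have sg'0 : 0 < sg' by rewrite /sg'; lra.
have sg'1 : sg' < 1 by rewrite /sg'; lra.
have ri0 : 0 < r^-1 by rewrite invr_gt0.
have kr : (sg' `^ r^-1) `^ r = sg' by rewrite -powRrM mulVf ?gt_eqF// powRr1// ltW.
exists (sg' `^ r^-1), (sg / sg'); split.
- exact: powR_gt0.
- have E1 : 1 `^ r^-1 = 1 by rewrite powR1.
  by rewrite -[ltRHS]E1; apply: gt0_ltr_powR; rewrite ?nnegrE// ltW.
- by rewrite divr_ge0// ltW.
- by rewrite ltr_pdivrMr// mul1r /sg'; lra.
move=> n; rewrite (_ : \sum_(k < n) _ = (\sum_(k < n) az k `^ r) / sg').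
  by rewrite ler_pM2r ?invr_gt0.
rewrite mulr_suml; apply: eq_bigr => k _.
by rewrite powRM ?invr_ge0 ?powR_ge0// powRV ?powR_gt0// kr.
Qed.

(** The ratios a_i / |a| of the tail lie in [0, 1] and add up to at most 1, and their r-th powers
    are no larger because r >= 1. *)
Lemma sum_adapted_radius_le n N (eta : R) (rho : 'I_n -> R) (a : {ffun 'I_n -> nat}) :
  0 <= eta -> \sum_i (adapted_radius N eta rho a i) `^ r <=
    \sum_(i < n | (i < N)%N) rho i `^ r + eta `^ r.
Proof.
move=> eta0; rewrite (bigID (fun i : 'I_n => (i < N)%N))/= lerD//.
  rewrite le_eqVlt; apply/orP; left; apply/eqP.
  by apply: eq_bigr => i iN; rewrite /adapted_radius iN.
have am (i : 'I_n) : (N <= i)%N -> (a i <= tail_deg N a)%N.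
  by move=> Ni; rewrite /tail_deg (bigD1 i)//= leq_addr.
apply: (@le_trans _ _ (\sum_(i < n | (N <= i)%N) eta `^ r * ((a i)%:R / (tail_deg N a)%:R))).
  rewrite (eq_bigl (fun i : 'I_n => (N <= i)%N)) => [|i]; last by rewrite -leqNgt.
  apply: ler_sum => i Ni; rewrite /adapted_radius ltnNge Ni/= -mulrA.
  have q0 : 0 <= (a i)%:R / (tail_deg N a)%:R :> R by rewrite divr_ge0.
  rewrite powRM//; apply: ler_wpM2l; first exact: powR_ge0.
  have [->|qn] := eqVneq ((a i)%:R / (tail_deg N a)%:R : R) 0; first by rewrite powR0// gt_eqF.
  apply: ge1r_powR => //; rewrite lt_def qn q0/=.
  have [m0|m0] := posnP (tail_deg N a); first by rewrite m0 invr0 mulr0.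
  by rewrite ler_pdivrMr ?ltr0n// mul1r ler_nat am.
rewrite -mulr_sumr -[leRHS]mulr1; apply: ler_wpM2l; first exact: powR_ge0.
rewrite -mulr_suml -natr_sum -/(tail_deg N a).
have [->|m0] := posnP (tail_deg N a); first by rewrite mul0r.
by rewrite divff// pnatr_eq0 -lt0n.
Qed.

Lemma mem_monHoo_of_l1 (B : R) : (forall n, \sum_(k < n) az k <= B) -> monHoo r1 z.
Proof.
move=> zB; apply: monHooI => // M M0.
have [kappa [tau [k0 k1 t0 t1 hk]]] := exists_dilation.
(* [eta] takes half of the slack, and [V] is fixed by e V / eta = 1/2, the ratio of the geometric
   series over tail degrees. *)
pose eta := (1 - tau) / 2; have eta0 : 0 < eta by rewrite /eta; lra.
have eta1 : eta <= 1 by rewrite /eta; lra.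
pose V := eta / (2 * expR 1); have V0 : 0 < V by rewrite /V divr_gt0// mulr_gt0// expR_gt0.
have [N hN] := exists_small_tail az0 zB V0.
exists (M * (2 * ((1 - kappa)^-1) ^+ N)) => n c hc s us.
have Ve : expR 1 * V / eta <= 2^-1.
  rewrite /V le_eqVlt; apply/orP; left; apply/eqP; field.
  by rewrite !gt_eqF ?expR_gt0.
pose v (i : 'I_n) := az i; have v0 i : 0 <= v i by exact: az0.
have := sum_tail_weight_le (ltW k0) k1 V0 eta0 v0 (hN n) Ve us => hw.
apply: le_trans (_ : M * \sum_(a <- s) tail_weight N kappa eta v a <= _); last exact: ler_wpM2l.
rewrite mulr_sumr; apply: ler_sum => a _.
pose rho (i : 'I_n) := az i / kappa.
have rho0 i : 0 <= rho i by rewrite divr_ge0// ltW.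
have ar0 i : 0 <= adapted_radius N eta rho a i.
  by rewrite /adapted_radius; case: ifP => _; rewrite ?rho0// divr_ge0// mulr_ge0// ltW.
have Da : ell_radius r (adapted_radius N eta rho a).
  split => //; apply: (le_lt_trans (sum_adapted_radius_le _ _ _ (ltW eta0))).
  apply: (@le_lt_trans _ _ (tau + eta)); last by rewrite /eta; lra.
  rewrite lerD//.
    apply: le_trans (hk n); rewrite big_mkcond; apply: ler_sum => i _.
    by case: ifP => // _; exact: powR_ge0.
  by apply: ge1r_powR => //; rewrite eta0.
have := controlled_cauchy hc a Da ar0 M0.
have mw : mon a v <= tail_weight N kappa eta v a * mon a (adapted_radius N eta rho a).
  apply: (mon_le_tail_weight eta0 v0) => // i _.
  by rewrite mulrCA divff ?mulr1// gt_eqF.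
have w0 := tail_weight_ge0 N (ltW k0) eta0 v0 a.
move=> h; apply: (le_trans (ler_wpM2l (normc_ge0 _) mw)).
by rewrite mulrCA [M * _]mulrC ler_wpM2l.
Qed.

Lemma mem_monHoo_of_lp (p B : R) : 0 < p -> p^-1 = 2^-1 + r^-1 ->
  (forall n, \sum_(k < n) az k `^ p <= B) -> monHoo r1 z.
Proof.
move=> p0 pE zB; apply: monHooI => // M M0.
have [kappa [tau [k0 k1 t0 t1 hk]]] := exists_dilation.
have pr : p / 2 + p / r = 1 by rewrite -mulrDr -pE divff// gt_eqF.
have pr0 : 0 < p / r by rewrite divr_gt0.
(* This bound on the tail of |z|^p is used twice: it keeps the tail of [rho] inside the ball, and it
   keeps the tail sum of the squares of [y] at most 1/2. *)
have e0 : 0 < (1 - tau) / 2 by lra.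
have [N hN] := exists_small_tail (fun k => powR_ge0 (az k) p) zB e0.
pose G := (1 - kappa ^+ 2)^-1.
have kk : kappa ^+ 2 < 1 by rewrite expr2; nra.
have G1 : 1 <= G by rewrite /G invf_ge1 ?subr_gt0// gerBl sqr_ge0.
(* M^2 bounds the sum of the squares of |c_a| rho^a, and [2 * G ^+ N] that of the squares of y^a:
   one [G] per head variable, and 2 for the tail, where the product of the 1 - y_i^2 is at least
   1/2. The two are joined by uv <= (u^2 + v^2) / 2. *)
exists ((M ^+ 2 + 2 * G ^+ N) / 2) => n c hc s us.
pose rho (i : 'I_n) := if (i < N)%N then az i / kappa else az i `^ (p / r).
pose y (i : 'I_n) := if (i < N)%N then kappa else az i `^ (p / 2).
have rho0 i : 0 <= rho i by rewrite /rho; case: ifP => _; rewrite ?powR_ge0// divr_ge0// ltW.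
have y0 i : 0 <= y i by rewrite /y; case: ifP => _; rewrite ?powR_ge0// ltW.
have zE i : az (val i) = rho i * y i.
  rewrite /rho /y; case: ifP => _; first by rewrite mulfVK// gt_eqF.
  by rewrite -powRD addrC pr ?powRr1// oner_eq0.
have Drho : ell_radius r rho.
  split => //; rewrite (bigID (fun i : 'I_n => (i < N)%N))/=.
  apply: (@le_lt_trans _ _ (tau + (1 - tau) / 2)); last by lra.
  rewrite lerD//.
    apply: le_trans (hk n); rewrite big_mkcond; apply: ler_sum => i _.
    by rewrite /rho; case: (i < N)%N => //; exact: powR_ge0.
  apply: le_trans (hN n); rewrite le_eqVlt; apply/orP; left; apply/eqP.
  apply: eq_big => [i|i /negbTE iN]; first by rewrite -leqNgt.
  by rewrite /rho iN -powRrM mulfVK// gt_eqF.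
have bes := controlled_bessel hc Drho rho0 us.
have tail1 i : (N <= i)%N -> (i < n)%N -> az i `^ p <= 2^-1.
  move=> Ni ni; apply: (@le_trans _ _ ((1 - tau) / 2)); last by lra.
  apply: le_trans (hN n); rewrite (bigD1 (Ordinal ni))//= lerDl.
  by apply: sumr_ge0 => j _; exact: powR_ge0.
have y2 i : y i ^+ 2 = if (i < N)%N then kappa ^+ 2 else az i `^ p.
  rewrite /y; case: ifP => // _.
  by rewrite -powR_mulrn ?powR_ge0// -powRrM mulfVK.
have y21 i : 0 <= y i ^+ 2 < 1.
  rewrite sqr_ge0 y2; case: ltnP => // Ni.
  by have := tail1 i Ni (ltn_ord i); lra.
have hy : \sum_(a <- s) mon a y ^+ 2 <= 2 * G ^+ N.
  have [d sd] := exists_deg_bound s.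
  have sq a i : a \in s -> (a i < d.+1)%N by move=> /sd; rewrite ltnS; exact/leq_trans/leq_deg.
  have F0 (i : 'I_n) (b : nat) : 0 <= (y i ^+ 2) ^+ b by rewrite exprn_ge0// sqr_ge0.
  apply: (@le_trans _ _ (\sum_(a <- s) \prod_i (y i ^+ 2) ^+ a i)).
    apply: ler_sum => a _; rewrite /mon -prodrXl le_eqVlt; apply/orP; left; apply/eqP.
    by apply: eq_bigr => i _; rewrite -!exprM mulnC.
  apply: (le_trans (ler_sum_box us sq F0)).
  apply: (@le_trans _ _ (\prod_i (1 - y i ^+ 2)^-1)).
    apply: ler_prod => i _; rewrite sumr_ge0//=.
    by have /andP[a1 a2] := y21 i; apply: geometric_sum_le.
  rewrite (bigID (fun i : 'I_n => (i < N)%N))/= mulrC ler_pM//.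
  - by apply: prodr_ge0 => i _; have := y21 i; rewrite invr_ge0; lra.
  - by apply: prodr_ge0 => i _; have := y21 i; rewrite invr_ge0; lra.
  - rewrite prodfV -[leRHS]invrK lef_pV2 ?posrE ?invr_gt0//; last first.
      by apply: prodr_gt0 => i _; have := y21 i; lra.
    apply: le_trans (one_sub_sum_le_prod _ _); last by move=> i _; have := y21 i; lra.
    have : \sum_(i < n | ~~ (i < N)%N) y i ^+ 2 <= (1 - tau) / 2.
      apply: le_trans (hN n); rewrite le_eqVlt; apply/orP; left; apply/eqP.
      apply: eq_big => [i|i /negbTE iN]; first by rewrite -leqNgt.
      by rewrite y2 iN.
    lra.
  rewrite big_mkcond (eq_bigr (fun i : 'I_n => if (i < N)%N then G else 1)).
    by rewrite prod_lt_const; apply: ler_weXn2l; rewrite ?geq_minr.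
  move=> i _; rewrite y2; case: (i < N)%N => //.
apply: (@le_trans _ _ ((\sum_(a <- s) (normc (c a) * mon a rho) ^+ 2 +
    \sum_(a <- s) mon a y ^+ 2) / 2)).
  rewrite -big_split mulr_suml; apply: ler_sum => a _ /=.
  have -> : mon a (fun i => normc (z (val i))) = mon a rho * mon a y.
    by rewrite -monM; apply: eq_bigr => i _; rewrite -zE.
  have := sqr_ge0 (normc (c a) * mon a rho - mon a y).
  rewrite mulrA; set u := _ * mon a rho; set w := mon a y; lra.
by rewrite ler_pM2r ?invr_gt0// lerD.
Qed.

End Inclusion.

(** * Elements of the set of monomial convergence outside the sequence space *)

Section Blocks.
Variable b : nat.
Hypothesis b2 : (2 <= b)%N.

(* The blocks are the intervals [[bstart J, bstart J.+1[]; each one is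
   exponentially larger than everything before it. *)
Fixpoint bstart (J : nat) : nat :=
  if J is J'.+1 then (bstart J' + b ^ (bstart J' + J'.+1))%N else 0%N.

Definition bsize (J : nat) : nat := (b ^ (bstart J + J.+1))%N.

Lemma bstartS J : bstart J.+1 = (bstart J + bsize J)%N. Proof. by []. Qed.

Lemma bsize_gt J : (bstart J + J.+1 < bsize J)%N.
Proof. exact: ltn_expl. Qed.

Lemma bsize_gt0 J : (0 < bsize J)%N.
Proof. exact: leq_ltn_trans (bsize_gt J). Qed.

Lemma leq_bstart J : (J <= bstart J)%N.
Proof. by elim: J => // J ih; rewrite bstartS; have := bsize_gt J; lia. Qed.

Lemma bstart_mono : {homo bstart : i j / (i <= j)%N}.
Proof. by apply: homo_leq => [//|? ? ?|J]; [exact: leq_trans|rewrite bstartS leq_addr]. Qed.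

Lemma exists_block k : exists J, (k < bstart J.+1)%N.
Proof. by exists k; exact: leq_bstart. Qed.

Definition blk (k : nat) : nat := ex_minn (exists_block k).

Lemma blk_lt k : (k < bstart (blk k).+1)%N.
Proof. by rewrite /blk; case: ex_minnP. Qed.

Lemma blk_ge k : (bstart (blk k) <= k)%N.
Proof.
rewrite /blk; case: ex_minnP => -[|J] // _ h; rewrite leqNgt; apply/negP => /h.
by rewrite ltnn.
Qed.

Lemma blk_eq k J : (bstart J <= k)%N -> (k < bstart J.+1)%N -> blk k = J.
Proof.
move=> h1 h2; apply/eqP; rewrite eqn_leq; apply/andP; split; rewrite leqNgt; apply/negP => h.
- by have := leq_trans h2 (bstart_mono h); rewrite ltnNge blk_ge.
- by have := leq_trans (blk_lt k) (bstart_mono h); rewrite ltnNge h1.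
Qed.

Lemma blk_leq k : (blk k <= k)%N.
Proof. exact: leq_trans (leq_bstart _) (blk_ge k). Qed.

Lemma sum_bstart (R : nmodType) (F : nat -> R) J :
  \sum_(k < bstart J) F k = \sum_(j < J) \sum_(k < bsize j) F (bstart j + k)%N.
Proof.
elim: J => [|J ih]; first by rewrite !big_ord0.
by rewrite bstartS big_split_ord/= ih big_ord_recr.
Qed.

Lemma blk_shift j (k : 'I_(bsize j)) : blk (bstart j + k) = j.
Proof. by apply: blk_eq; rewrite ?leq_addr// bstartS ltn_add2l. Qed.

Lemma sum_blk (R : pzSemiRingType) (F : nat -> R) J :
  \sum_(k < bstart J) F (blk k) = \sum_(j < J) (bsize j)%:R * F j.
Proof.
rewrite (sum_bstart (fun k => F (blk k))); apply: eq_bigr => j _.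
under eq_bigr do rewrite blk_shift.
by rewrite sumr_const card_ord mulr_natl.
Qed.

Lemma sum_ord_le_blk (R : numDomainType) (F : nat -> R) n : (forall k, 0 <= F k) ->
  \sum_(k < n) F k <= \sum_(k < bstart n) F k.
Proof.
move=> F0; rewrite -!(big_mkord xpredT) [leRHS](@big_cat_nat _ _ _ n) ?leq_bstart//=.
by rewrite lerDl sumr_ge0.
Qed.

End Blocks.

(** * Properness for r >= 2 *)

Section SquareRootSequence.
Variables (R : realType) (r s : R).
Hypotheses (r2 : 2 <= r) (s0 : 0 < s) (sE : s^-1 = 2^-1 + r^-1).
Local Notation normc := (@Normc.normc R).
Let r0 : 0 < r. Proof. exact: lt_le_trans r2. Qed.
Local Notation blk := (blk (leqnn 2)).
Local Notation bstart := (bstart 2).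
Local Notation bsize := (bsize 2).

(** The r-th powers over block J add up to (J+1)^(-r/s) / 4, summable since r/s = r/2 + 1 >= 2. The
    exponent r/s is the one for which, after multiplication by the square-root weights, the s-th
    powers add up to a multiple of 1/(J+1) at least. *)
Definition block_radius (k : nat) : R :=
  ((blk k).+1%:R^-1 `^ (r / s) / (4 * (bsize (blk k))%:R)) `^ r^-1.

Lemma block_radius_ge0 k : 0 <= block_radius k.
Proof. exact: powR_ge0. Qed.

Lemma bsizeR_gt0 J : 0 < (bsize J)%:R :> R.
Proof. by rewrite ltr0n bsize_gt0. Qed.

Lemma sum_inv_sqr_le J : \sum_(j < J) (j.+1%:R^-1) ^+ 2 <= 2 :> R.
Proof.
case: J => [|J]; first by rewrite big_ord0.
suff : \sum_(j < J.+1) (j.+1%:R^-1) ^+ 2 <= 2 - J.+1%:R^-1 :> R.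
  have : 0 < J.+1%:R^-1 :> R by rewrite invr_gt0.
  by move=> h0 h; apply: (le_trans h); rewrite lerBlDr lerDl ltW.
elim: J => [|J ih]; first by rewrite big_ord1 invr1 expr1n; lra.
rewrite big_ord_recr/=.
suff : (J.+2%:R^-1) ^+ 2 <= J.+1%:R^-1 - J.+2%:R^-1 :> R.
  by move=> h; apply: (le_trans (lerD ih h)); rewrite addrA subrK.
have j0 : 0 < J.+1%:R :> R by [].
rewrite -[J.+2]addn1 natrD; move: J.+1%:R j0 => x x0.
rewrite -subr_ge0 (_ : _ - _ = (x * (x + 1) ^+ 2)^-1).
  by rewrite invr_ge0 mulr_ge0 ?sqr_ge0// ltW.
by field; rewrite !gt_eqF//; lra.
Qed.

Lemma sum_block_radius_le n : \sum_(k < n) block_radius k `^ r <= 2^-1.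
Proof.
apply: (le_trans (sum_ord_le_blk (leqnn 2) n (fun k => powR_ge0 (block_radius k) r))).
pose F (J : nat) : R := J.+1%:R^-1 `^ (r / s) / (4 * (bsize J)%:R).
rewrite (eq_bigr (fun k : 'I_(bstart n) => F (blk k))) => [|k _]; last first.
  by rewrite /block_radius -powRrM mulVf ?gt_eqF// powRr1//.
rewrite sum_blk; apply: (@le_trans _ _ (\sum_(j < n) (j.+1%:R^-1) ^+ 2 / 4)).
  apply: ler_sum => j _; rewrite /F (_ : _ * _ = j.+1%:R^-1 `^ (r / s) / 4); last first.
    by field; rewrite gt_eqF ?bsizeR_gt0.
  rewrite ler_pM2r ?invr_gt0// -powR_mulrn ?invr_ge0//.
  apply: ger_powR; first by rewrite invr_gt0 ltr0n/= invf_le1 ?ltr0n// ler1n.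
  have -> : r / s = r / 2 + 1 by rewrite sE mulrDr divff// gt_eqF.
  by move: r2; lra.
rewrite -mulr_suml; have := sum_inv_sqr_le n; lra.
Qed.

Definition sqrt_seq (k : nat) : R := block_radius k * ((Num.sqrt k.+2%:R)^-1 / 8).

Lemma sqrt_seq_ge0 k : 0 <= sqrt_seq k.
Proof. by rewrite mulr_ge0 ?block_radius_ge0// divr_ge0// invr_ge0 sqrtr_ge0. Qed.

(** In block J one has k + 2 <= 2 n_J, since the block outweighs all that precedes it, and 8
    sqrt(k+2) is the root of 64 (k+2); hence 128. The exponents s/r and s/2 add up to 1. *)
Lemma sqrt_seq_powR_ge k :
  (blk k).+1%:R^-1 / (128 * (bsize (blk k))%:R) <= sqrt_seq k `^ s.
Proof.
set J := blk k; set S : R := (bsize J)%:R; have S0 : 0 < S by exact: bsizeR_gt0.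
have S0' := ltW S0; have s0' := ltW s0.
have t_ge0 : 0 <= (4 * S)^-1 by rewrite invr_ge0 mulr_ge0.
pose t : R := (128 * S)^-1; have t0 : 0 < t by rewrite invr_gt0 mulr_gt0.
have ss : s / r + s / 2 = 1 by rewrite addrC -mulrDr -sE divff// gt_eqF.
have q0 : 0 <= J.+1%:R^-1 :> R by rewrite invr_ge0.
have hk : t <= (k.+2%:R * 64)^-1.
  rewrite lef_pV2 ?posrE ?mulr_gt0//.
  have : (k.+2 <= 2 * bsize J)%N.
    have := blk_lt (leqnn 2) k; have := bsize_gt (leqnn 2) J; rewrite bstartS -/J; lia.
  rewrite -(ler_nat R) natrM -/S; lra.
have E : (Num.sqrt k.+2%:R)^-1 / 8 = ((k.+2%:R * 64)^-1) `^ 2^-1 :> R.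
  rewrite powR12_sqrt ?invr_ge0 ?mulr_ge0// sqrtrV ?mulr_ge0// sqrtrM// invfM.
  by rewrite (_ : (64 : R) = 8 ^+ 2) ?sqrtr_sqr ?ger0_norm//; ring.
rewrite /sqrt_seq E powRM ?powR_ge0// /block_radius -/J -/S -!powRrM.
have -> : J.+1%:R^-1 / (128 * S) = J.+1%:R^-1 * (t `^ (s / r) * t `^ (s / 2)).
  by rewrite -powRD ss ?powRr1 ?oner_eq0// ltW.
rewrite mulrA ler_pM ?mulr_ge0 ?powR_ge0//; last first.
  rewrite [2^-1 * s]mulrC; apply: ge0_ler_powR;
    rewrite ?nnegrE ?divr_ge0 ?invr_ge0 ?mulr_ge0// ltW.
rewrite powRM ?powR_ge0// -powRrM.
have -> : r / s * (r^-1 * s) = 1 by field; rewrite !gt_eqF.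
rewrite powRr1// ler_wpM2l// mulrC; apply: ge0_ler_powR.
- by rewrite mulr_ge0// invr_ge0 ltW.
- by rewrite nnegrE ltW.
- by rewrite nnegrE.
- by rewrite lef_pV2 ?posrE ?mulr_gt0// ler_pM2r// ler_nat.
Qed.

Lemma exists_monHoo_not_ellp (r1 : 1 <= r) :
  exists2 z : ell r1, monHoo r1 z & (z : nat -> Cplx R) \notin ellp s.
Proof.
pose zf k : Cplx R := ((sqrt_seq k)%:C)%C.
have nz k : normc (zf k) = sqrt_seq k by rewrite normc_real ger0_norm ?sqrt_seq_ge0.
have lt12 : 2^-1 < 1 :> R by lra.
have zr n : \sum_(k < n) normc (zf k) `^ r <= 2^-1.
  apply: le_trans (sum_block_radius_le n); apply: ler_sum => k _; rewrite nz.
  apply: ge0_ler_powR; rewrite ?nnegrE ?sqrt_seq_ge0 ?block_radius_ge0//; first exact: ltW.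
  rewrite /sqrt_seq ler_piMr ?block_radius_ge0//.
  apply: (@le_trans _ _ (1 / 8)); last by lra.
  rewrite ler_pM2r ?invr_gt0// invf_le1 ?sqrtr_gt0//.
  by rewrite -{1}sqrtr1 ler_wsqrtr// ler1n.
have [z zE uz] := exists_ell r1 lt12 zr; exists z.
  apply: monHooI => // M M0; exists (5 * M) => n c hc t ut.
  have Drho : ell_radius r (fun i : 'I_n => block_radius i).
    split => [i|]; first exact: block_radius_ge0.
    exact: le_lt_trans (sum_block_radius_le n) lt12.
  apply: le_trans (controlled_hweight hc Drho (fun i => block_radius_ge0 i) M0 ut).
  apply: ler_sum => a _; apply: ler_wpM2l; first exact: normc_ge0.
  by rewrite le_eqVlt; apply/orP; left; apply/eqP; apply: eq_bigr => i _; rewrite zE nz.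
apply/negP => /(ellp_bound _ s0)[B hB].
(* A bound on the s-th powers would bound the harmonic series, as block j contributes at least
   1/(128 (j+1)). *)
apply: (@dvg_harmonic R); apply: nondecreasing_is_cvgn.
  by apply/nondecreasing_seqP => m; rewrite /series/= big_nat_recr//= lerDl invr_ge0.
exists (128 * B) => _ [J _ <-]; rewrite /series/= big_mkord.
rewrite -ler_pdivrMl//; apply: le_trans (hB (bstart J)).
apply: (@le_trans _ _ (\sum_(k < bstart J) (blk k).+1%:R^-1 / (128 * (bsize (blk k))%:R))).
  rewrite (sum_blk (leqnn 2) (fun j => j.+1%:R^-1 / (128 * (bsize j)%:R))) mulr_sumr.
  apply: ler_sum => j _; rewrite le_eqVlt; apply/orP; left; apply/eqP.
  by field; rewrite gt_eqF ?bsizeR_gt0//= nat1r pnatr_eq0.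
by apply: ler_sum => k _; rewrite zE nz; exact: sqrt_seq_powR_ge.
Qed.

End SquareRootSequence.

(** Crude, from x + y <= 2 max(x, y); the constants of the block construction absorb the factor
    2. *)
Lemma powR_add_le (R : realType) (r x y : R) : 0 <= r -> 0 <= x -> 0 <= y ->
  (x + y) `^ r <= (2 * x) `^ r + (2 * y) `^ r.
Proof.
move=> r0; wlog xy : x y / x <= y => [hw x0 y0|x0 y0].
  have [xy|/ltW yx] := leP x y; first exact: hw.
  by rewrite addrC [leRHS]addrC; exact: hw.
apply: (@le_trans _ _ ((2 * y) `^ r)); last by rewrite lerDr powR_ge0.
by apply: ge0_ler_powR; rewrite ?nnegrE ?addr_ge0 ?mulr_ge0//; lra.
Qed.

(** * Properness for r < 2 *)

Section FlatSequence.
Variables (R : realType) (r : R) (b : nat).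
Hypotheses (r1 : 1 < r) (b2 : (2 <= b)%N) (hb : 2 <= b%:R `^ (1 - r^-1)).
Local Notation normc := (@Normc.normc R).
Local Notation blk := (blk b2).
Local Notation bstart := (bstart b).
Local Notation bsize := (bsize b).
Let r0 : 0 < r. Proof. exact: lt_trans r1. Qed.
Let e : R := expR 1.
Let e1 : 1 <= e. Proof. by rewrite /e -[leLHS]expR0 ler_expR. Qed.
Let e0 : 0 < e. Proof. exact: expR_gt0. Qed.
Let S J : R := (bsize J)%:R.
Let S0 J : 0 < S J. Proof. by rewrite ltr0n bsize_gt0. Qed.
Let S_ge0 J : 0 <= S J. Proof. exact: ltW. Qed.
Let r1w : 1 <= r. Proof. exact: ltW. Qed.

(** The l_1 norm of each block, chosen so that with eta = 1/16 the ratio e A / eta demanded by the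
    tail weights is exactly 1/2. *)
Definition flat_mass : R := (32 * expR 1)^-1.
Definition flat_seq (k : nat) : R := flat_mass / (bsize (blk k))%:R.

Lemma flat_mass_gt0 : 0 < flat_mass.
Proof. by rewrite invr_gt0 mulr_gt0 ?expR_gt0. Qed.

Lemma flat_mass_le : flat_mass <= 32^-1.
Proof. by rewrite lef_pV2 ?posrE ?mulr_gt0 ?expR_gt0// ler_peMr. Qed.

Lemma flat_seq_ge0 k : 0 <= flat_seq k.
Proof. by rewrite divr_ge0 ?ler0n// ltW// flat_mass_gt0. Qed.

(** This is where the base enters: [hb] turns each factor [b] of the block size into a gain of at
    least 2. *)
Lemma bsize_powR_le J : S J `^ (- (1 - r^-1)) <= 2^-1 ^+ (bstart J + J.+1).
Proof.
rewrite powRN exprVn lef_pV2 ?posrE ?powR_gt0 ?exprn_gt0//.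
rewrite /S /bsize natrX -powR_mulrn ?ler0n// -powRrM mulrC powRrM powR_mulrn ?powR_ge0//.
by apply: lerXn2r; rewrite ?nnegrE ?powR_ge0.
Qed.

(** Block j contributes (4 A)^r n_j^(1-r), and r - 1 >= 1 - 1/r. The factor 4 leaves room for two
    doublings, that of the head radius and that of [powR_add_le]. *)
Lemma sum_flat_seq_powR_le n : \sum_(k < n) (4 * flat_seq k) `^ r <= 8^-1.
Proof.
have A0 := flat_mass_gt0; have A1 := flat_mass_le.
apply: (le_trans (sum_ord_le_blk b2 n (fun k => powR_ge0 (4 * flat_seq k) r))).
rewrite /flat_seq (sum_blk b2 (fun j => (4 * (flat_mass / S j)) `^ r)).
apply: (@le_trans _ _ (\sum_(j < n) 8^-1 * (2^-1 * 2^-1 ^+ j))); last first.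
  rewrite -mulr_sumr -mulr_sumr ler_piMr ?invr_ge0//.
  have h0 : 0 <= 2^-1 :> R by rewrite invr_ge0.
  have h1 : 2^-1 < 1 :> R by lra.
  have := geometric_sum_le n h0 h1; rewrite (_ : (1 - 2^-1)^-1 = 2 :> R); last by field.
  by move: (\sum_(j < n) _) => x; lra.
apply: ler_sum => j _; rewrite -/(S j) mulrA powRM ?invr_ge0//; last by rewrite mulr_ge0// ltW.
rewrite powRV// mulrCA; apply: ler_pM; rewrite ?powR_ge0 ?mulr_ge0 ?invr_ge0 ?powR_ge0//.
  apply: (@le_trans _ _ (4 * flat_mass)); last by lra.
  by apply: ge1r_powR => //; lra.
rewrite -powRN -{1}(powRr1 (ltW (S0 j))) -powRD; last by apply/implyP => _; rewrite gt_eqF.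
apply: (@le_trans _ _ (S j `^ (- (1 - r^-1)))).
  apply: ler_powR; first by rewrite ler1n bsize_gt0.
  have ri : r^-1 <= 1 by rewrite invf_le1// ltW.
  have rr : r * r^-1 = 1 by rewrite divff// gt_eqF.
  have : 0 <= (r - 1) * (1 - r^-1) by rewrite mulr_ge0 ?subr_ge0.
  by move: (r^-1) rr => x rr; lra.
apply: (le_trans (bsize_powR_le j)); rewrite -exprS; apply: ler_wiXn2l; rewrite ?invr_ge0//.
  by rewrite invf_le1// ler1n.
by rewrite leq_addl.
Qed.

Lemma sum_flat_block_le n J :
  \sum_(i < n | (bstart J <= i)%N) (if (i < bstart J.+1)%N then flat_seq i else 0) <= flat_mass.
Proof.
have f0 k : 0 <= (if blk k == J then flat_seq k else 0).
  by case: ifP => // _; exact: flat_seq_ge0.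
apply: (@le_trans _ _ (\sum_(k < n) if blk k == J then flat_seq k else 0)).
  rewrite big_mkcond; apply: ler_sum => k _; case: ifP => // h1; case: ifP => // h2.
  by rewrite (blk_eq b2 h1 h2) eqxx.
apply: (le_trans (sum_ord_le_blk b2 n f0)).
rewrite /flat_seq (sum_blk b2 (fun j => if j == J then flat_mass / S j else 0)).
have A0 := ltW flat_mass_gt0.
have [Jn|nJ] := ltnP J n; last first.
  rewrite big1// => j _; case: eqP => [jJ|_]; last by rewrite mulr0.
  by have := ltn_ord j; rewrite jJ ltnNge nJ.
rewrite (bigD1 (Ordinal Jn))//= eqxx big1 ?addr0; last first.
  by move=> j /eqP jJ; case: eqP => [h|]; rewrite ?mulr0//; case: jJ; exact: val_inj.
rewrite mulrCA divff ?mulr1//; apply: lt0r_neq0; exact: S0.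
Qed.

Section Estimate.
Variables (n : nat) (c : {ffun 'I_n -> nat} -> R[i]) (M : R).
Hypotheses (M0 : 0 <= M) (hc : coef_controlled (@ell_radius R r n) c M).
Let z (i : 'I_n) : R := flat_seq i.
Let z0 i : 0 <= z i. Proof. exact: flat_seq_ge0. Qed.

(** The derivative along [u] bounds the sum over k for each fixed [a], and tail weights then sum
    over [a]. The head costs 2^(bstart J), which the gain [g] cancels with 2^(-(J+1)) to spare. *)
Lemma block_sum_le J (B : seq {ffun 'I_n -> nat}) : uniq B ->
  (forall a (i : 'I_n), a \in B -> (0 < a i)%N -> (i < bstart J.+1)%N) ->
  \sum_(a <- B) \sum_(k < n | blk k == J) z k * normc (c (incr a k)) * mon a z <= M * 2^-1 ^+ J.
Proof.
move=> uB Bs.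
pose g := S J `^ (- (1 - r^-1)).
have g0 : 0 <= g by exact: powR_ge0.
(* A direction of l_r norm at most 1/16, constant on block J; there z is [16 * flat_mass * g] times
   [u], the gain being the price of l_1 against l_r normalisation. *)
pose u (i : 'I_n) : R := if blk i == J then (16 * S J `^ r^-1)^-1 else 0.
have u0 i : 0 <= u i.
  by rewrite /u; case: ifP => // _; rewrite invr_ge0 mulr_ge0 ?powR_ge0.
have uz (i : 'I_n) : blk i == J -> z i = 16 * flat_mass * g * u i.
  move=> iJ; rewrite /u iJ /z /flat_seq (eqP iJ) -/(S J) /g.
  rewrite opprB powRB; last by apply/implyP => _; rewrite gt_eqF.
  rewrite powRr1//; field.
  by rewrite !gt_eqF// ?powR_gt0// S0.
pose eta : R := 16^-1; have eta0 : 0 < eta by rewrite invr_gt0.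
(* Cut at the end of block J, which keeps the tail mass at most [flat_mass]; the multi-indices in
   [B] do not reach further. *)
pose v (i : 'I_n) := if (i < bstart J.+1)%N then z i else 0.
have v0 i : 0 <= v i by rewrite /v; case: ifP.
have A0 := flat_mass_gt0; have A1 := flat_mass_le.
have k0 : 0 <= 2^-1 :> R by rewrite invr_ge0.
have k1 : 2^-1 < 1 :> R by lra.
have Ve : expR 1 * flat_mass / eta <= 2^-1.
  rewrite /flat_mass /eta le_eqVlt; apply/orP; left; apply/eqP; field.
  by rewrite gt_eqF.
have hw := sum_tail_weight_le k0 k1 A0 eta0 v0 (sum_flat_block_le n J) Ve uB.
pose w a := tail_weight (bstart J) 2^-1 eta v a.
have w0 a : 0 <= w a by exact: tail_weight_ge0.
pose rho (i : 'I_n) := 2 * z i.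
have rho0 i : 0 <= rho i by rewrite mulr_ge0.
have point a : a \in B -> \sum_(k < n | blk k == J) z k * normc (c (incr a k)) * mon a z
    <= 16 * flat_mass * g * M * w a.
  move=> aB; pose ra := adapted_radius (bstart J) eta rho a.
  have ra0 i : 0 <= ra i.
    by rewrite /ra /adapted_radius; case: ifP => _; rewrite ?rho0// divr_ge0// mulr_ge0// ltW.
  have Dra : ell_radius r (fun i => ra i + u i).
    split => [i|]; first by rewrite addr_ge0.
    (* Head, tail and direction each take at most 1/8 of the unit ball. *)
    apply: (@le_lt_trans _ _ (\sum_i (2 * ra i) `^ r + \sum_i (2 * u i) `^ r)).
      by rewrite -big_split; apply: ler_sum => i _; apply: powR_add_le; rewrite // ltW.
    have h1 : \sum_i (2 * ra i) `^ r <= 8^-1 + 8^-1.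
      have eta20 : 0 <= 2 * eta by rewrite mulr_ge0// ltW.
      have := sum_adapted_radius_le (ltW r1) (bstart J) (fun i => 2 * rho i) a eta20.
      rewrite (eq_bigr (fun i => (2 * ra i) `^ r)) => [|i _]; last first.
        by rewrite /ra /adapted_radius; case: ifP => _ //; congr (_ `^ _); ring.
      move=> h; apply: (le_trans h); rewrite lerD//.
        apply: le_trans (sum_flat_seq_powR_le n); rewrite big_mkcond; apply: ler_sum => i _.
        case: ifP => _; last exact: powR_ge0.
        by rewrite /rho mulrA (_ : 2 * 2 = 4 :> R)//; ring.
      have -> : 8^-1 = 2 * eta by rewrite /eta; field.
      by apply: ge1r_powR; rewrite // mulr_gt0//= /eta; lra.
    have h2 : \sum_i (2 * u i) `^ r <= 8^-1.
      rewrite (eq_bigr (fun i : 'I_n => if blk i == J then 8^-1 `^ r / S J else 0)) => [|i _].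
        have f0 k : 0 <= (if blk k == J then 8^-1 `^ r / S J else 0).
          by case: ifP => // _; rewrite divr_ge0 ?powR_ge0// ltW.
        apply: (le_trans (sum_ord_le_blk b2 n f0)).
        rewrite (sum_blk b2 (fun j => if j == J then 8^-1 `^ r / S J else 0)).
        have h8 : 8^-1 `^ r <= 8^-1 :> R.
          by apply: ge1r_powR; rewrite // invr_gt0 ltr0n/= invf_le1// ler1n.
        have [Jn|nJ] := ltnP J n; last first.
          rewrite big1 ?invr_ge0// => j _; case: eqP => [jJ|_]; last by rewrite mulr0.
          by have := ltn_ord j; rewrite jJ ltnNge nJ.
        rewrite (bigD1 (Ordinal Jn))//= eqxx big1 ?addr0; last first.
          by move=> j /eqP jJ; case: eqP => [h|]; rewrite ?mulr0//; case: jJ; exact: val_inj.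
        rewrite mulrCA divff ?mulr1//; apply: lt0r_neq0; exact: S0.
      rewrite /u; case: ifP => _; last by rewrite mulr0 powR0// gt_eqF.
      have -> : 2 * (16 * S J `^ r^-1)^-1 = 8^-1 * (S J `^ r^-1)^-1.
        by field; rewrite gt_eqF// powR_gt0.
      rewrite powRM ?invr_ge0 ?powR_ge0//; congr (_ * _).
      by rewrite powRV ?powR_gt0// -powRrM mulVf ?gt_eqF// powRr1// ltW.
    by lra.
  have hd := controlled_derivative hc a Dra ra0 u0.
  have mw : mon a z <= w a * mon a ra.
    apply: (mon_le_tail_weight eta0 v0 z0) => i.
      by move=> _; rewrite /rho mulrA mulVf ?mul1r.
    by move=> _ ai; rewrite /v (Bs a i aB ai).
  apply: (@le_trans _ _ (16 * flat_mass * g * ((\sum_k u k * normc (c (incr a k))) * mon a z))).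
    rewrite mulrA mulr_sumr -mulr_suml; apply: ler_wpM2r; first exact: mon_ge0.
    rewrite big_mkcond; apply: ler_sum => k _; case: ifP => [kJ|_].
      by rewrite (uz _ kJ) -mulrA.
    by rewrite !mulr_ge0 ?normc_ge0// ltW.
  rewrite -[leRHS]mulrA; apply: ler_wpM2l; first by rewrite !mulr_ge0// ltW.
  have s0 : 0 <= \sum_k u k * normc (c (incr a k)).
    by apply: sumr_ge0 => k _; rewrite mulr_ge0 ?normc_ge0.
  apply: (le_trans (ler_wpM2l s0 mw)); rewrite mulrCA [M * _]mulrC.
  by apply: ler_wpM2l.
apply: (@le_trans _ _ (\sum_(a <- B) 16 * flat_mass * g * M * w a)).
  by rewrite big_seq [leRHS]big_seq; exact: ler_sum.
rewrite -mulr_sumr.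
have P0 : 0 <= 16 * flat_mass * g * M by rewrite !mulr_ge0// ltW.
apply: (le_trans (ler_wpM2l P0 hw)).
have -> : (1 - 2^-1)^-1 = 2 :> R by field.
have hg := bsize_powR_le J; rewrite -/g in hg.
have hp : 0 <= 2 ^+ bstart J :> R by rewrite exprn_ge0.
apply: (@le_trans _ _ (2^-1 * 2^-1 ^+ (bstart J + J.+1) * M * (2 * 2 ^+ bstart J))).
  apply: ler_wpM2r; first by rewrite mulr_ge0.
  apply: ler_wpM2r => //; apply: ler_pM => //; first by rewrite mulr_ge0// ltW.
  by lra.
rewrite exprD exprS !exprVn.
have p0 : 2 ^+ bstart J != 0 :> R by rewrite expf_neq0.
have p1 : 2 ^+ J != 0 :> R by rewrite expf_neq0.
have -> : 2^-1 * ((2 ^+ bstart J)^-1 * (2^-1 * (2 ^+ J)^-1)) * M * (2 * 2 ^+ bstart J) =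
   2^-1 * (M * (2 ^+ J)^-1) by field; rewrite p0 p1.
by rewrite ler_piMl ?mulr_ge0 ?invr_ge0 ?exprn_ge0// ltW.
Qed.

(** Removing one factor of the last variable k writes [a] as [incr (decr a k) k], which is the form
    [block_sum_le] controls for the block of k. The blocks contribute at most 2 M, the constant term
    M. *)
Lemma sum_flat_le (s : seq {ffun 'I_n -> nat}) : uniq s ->
  \sum_(a <- s) normc (c a) * mon a z <= 3 * M.
Proof.
move=> us; pose f a := normc (c a) * mon a z.
have f0 a : 0 <= f a by rewrite mulr_ge0 ?normc_ge0 ?mon_ge0.
rewrite (bigID (fun a => deg a == 0%N))/= (_ : 3 * M = M + 2 * M); last by ring.
apply: lerD.
  rewrite -big_filter; pose o : {ffun 'I_n -> nat} := [ffun=> 0%N].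
  have : {subset seq.filter (fun a => deg a == 0%N) s <= [:: o]}.
    move=> a; rewrite mem_filter inE => /andP[/eqP da _].
    by apply/eqP/ffunP => i; rewrite ffunE; apply/eqP; rewrite -leqn0 -da leq_deg.
  move=> /(ler_sum_subset (filter_uniq _ us)) -/(_ _ _ f0) h; apply: (le_trans h).
  have D0 : ell_radius r (fun _ : 'I_n => 0).
    by split=> //; rewrite big1// => i _; rewrite powR0// gt_eqF.
  have := controlled_cauchy hc o D0 (fun=> lexx 0) M0.
  by rewrite big_seq1 /f /mon !big1// => i _; rewrite ffunE expr0.
(* Different [a] can leave the same remainder, hence [undup]. The sum over all pairs of a remainder
   and a k in block J covers every [a] ending there, and any surplus is nonnegative. *)
pose B J := undup [seq decr p.1 p.2 | p <- [seq (a, k) | a <- s, k <- enum 'I_n] &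
  top p.1 p.2 && (blk p.2 == J)].
have BJ J : \sum_(k < n | blk k == J) \sum_(a <- s | top a k) f a <= M * 2^-1 ^+ J.
  apply: le_trans (block_sum_le (undup_uniq _) (_ : forall a i, a \in B J -> _)); last first.
    move=> a i; rewrite mem_undup => /mapP[[a' k]]; rewrite mem_filter /=.
    move=> /andP[/andP[/andP[_ /forallP ta] /eqP <-] _] ->; rewrite ffunE => ai.
    apply: leq_ltn_trans (blk_lt b2 k); rewrite leqNgt; apply/negP => ki.
    by have := ta i; rewrite ki => /eqP a'i; rewrite a'i in ai.
  rewrite [leRHS]exchange_big; apply: ler_sum => k kJ.
  pose G a := z k * normc (c (incr a k)) * mon a z.
  have G0 a : 0 <= G a.
    by apply: mulr_ge0; [apply: mulr_ge0 => //; exact: normc_ge0|exact: mon_ge0].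
  rewrite (_ : \sum_(a <- s | top a k) f a =
      \sum_(a <- [seq decr a k | a <- s & top a k]) G a); last first.
    rewrite big_map big_filter; apply: eq_bigr => a /andP[ak _].
    by rewrite /f /G decrK// (mon_decrK _ ak) mulrA [_ * z k]mulrC.
  apply: ler_sum_subset => //.
    rewrite map_inj_in_uniq ?filter_uniq// => a a'.
    rewrite !mem_filter => /andP[/andP[ak _] _] /andP[/andP[ak' _] _] E.
    by rewrite -(decrK ak) -(decrK ak') E.
  move=> x /mapP[a]; rewrite mem_filter => /andP[ta sa] ->; rewrite mem_undup.
  apply/mapP; exists (a, k) => //=; rewrite mem_filter /= ta kJ /=.
  by apply/allpairsP; exists (a, k); rewrite mem_enum.
apply: (@le_trans _ _ (\sum_k \sum_(a <- s | top a k) f a)).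
  rewrite (exchange_big_dep xpredT)//= big_mkcond; apply: ler_sum => a _.
  case: ifP => [/exists_top[k tk]|_]; last exact: sumr_ge0.
  by rewrite (bigD1 k)//= lerDl; exact: sumr_ge0.
rewrite (_ : \sum_k _ = \sum_(J < n) \sum_(k < n | blk k == J) \sum_(a <- s | top a k) f a);
    last first.
  rewrite [RHS](exchange_big_dep xpredT)//=; apply: eq_bigr => k _.
  have kn : (blk k < n)%N by exact: leq_ltn_trans (blk_leq b2 k) (ltn_ord k).
  rewrite [RHS](bigD1 (Ordinal kn))//= [X in _ + X]big1 ?addr0// => J /andP[/eqP kJ] /eqP[].
  exact: val_inj.
apply: (@le_trans _ _ (\sum_(J < n) M * 2^-1 ^+ J)); first by apply: ler_sum => J _.
rewrite -mulr_sumr mulrC; apply: ler_wpM2r => //.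
have h0 : 0 <= 2^-1 :> R by rewrite invr_ge0.
have h1 : 2^-1 < 1 :> R by lra.
apply: (le_trans (geometric_sum_le n h0 h1)).
by rewrite (_ : 1 - 2^-1 = 2^-1 :> R) ?invrK//; lra.
Qed.

End Estimate.

Lemma exists_monHoo_not_l1 (rge1 : 1 <= r) :
  exists2 z : ell rge1, monHoo rge1 z & (z : nat -> Cplx R) \notin ellp (1 : R).
Proof.
pose zf k : Cplx R := ((flat_seq k)%:C)%C.
have nz k : normc (zf k) = flat_seq k by rewrite normc_real ger0_norm ?flat_seq_ge0.
have lt81 : 8^-1 < 1 :> R by lra.
have zr n : \sum_(k < n) normc (zf k) `^ r <= 8^-1.
  apply: le_trans (sum_flat_seq_powR_le n); apply: ler_sum => k _; rewrite nz.
  have z0 := flat_seq_ge0 k.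
  apply: ge0_ler_powR; [exact: ltW|by rewrite nnegrE|by rewrite nnegrE mulr_ge0|].
  by rewrite ler_peMl// ler1n.
have [z zE uz] := exists_ell rge1 lt81 zr; exists z.
  apply: monHooI => // M M0; exists (3 * M) => n c hc s us.
  apply: le_trans (sum_flat_le M0 hc us).
  apply: ler_sum => a _; apply: ler_wpM2l; first exact: normc_ge0.
  by rewrite le_eqVlt; apply/orP; left; apply/eqP; apply: eq_bigr => i _; rewrite zE nz.
apply/negP => /(ellp_bound _ ltr01)[B hB].
have A0 := flat_mass_gt0.
have hJ J : J%:R * flat_mass <= B.
  apply: le_trans (hB (bstart J)); rewrite (eq_bigr (fun k : 'I_(bstart J) => flat_seq k)).
    rewrite /flat_seq (sum_blk b2 (fun j => flat_mass / S j)).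
    rewrite (eq_bigr (fun=> flat_mass)) ?sumr_const ?card_ord ?mulr_natl// => j _.
    by rewrite mulrCA divff ?mulr1//; apply: lt0r_neq0; exact: S0.
  by move=> k _; rewrite zE nz powRr1// flat_seq_ge0.
have := hJ (Num.truncn (B / flat_mass)).+1.
by rewrite -ler_pdivlMr// leNgt truncnS_gt.
Qed.

End FlatSequence.

Lemma exists_base_powR_ge (R : realType) (t : R) : 0 < t ->
  exists2 b, (2 <= b)%N & 2 <= b%:R `^ t.
Proof.
move=> t0; pose x : R := 2 `^ t^-1; exists (Num.truncn x).+2 => //.
have -> : 2 = x `^ t by rewrite /x -powRrM mulVf ?powRr1// gt_eqF.
apply: ge0_ler_powR; rewrite ?nnegrE ?powR_ge0//; first exact: ltW.
by apply: (le_trans (ltW (truncnS_gt x))); rewrite ler_nat.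
Qed.

Unset Implicit Arguments.

Theorem corollary5p6 (R : realType) (r s : R) (r1 : 1 < r)
    (hs : s^-1 = 2^-1 + (Num.max r 2)^-1) :
  unit_ball (ltW r1) `&` [set z : ell (ltW r1) | (z : nat -> Cplx R) \in ellp s]
    `<` monHoo (ltW r1).
Proof.
have r0 : 0 < r := lt_trans ltr01 r1.
have [r2|r2] := leP 2 r.
  rewrite max_l// in hs.
  have s0 : 0 < s by rewrite -invr_gt0 hs addr_gt0 ?invr_gt0.
  split=> [z [uz /= /(ellp_bound _ s0)[B hB]]|h]; first exact: (mem_monHoo_of_lp uz s0 hs hB).
  have [z zmon /negP] := exists_monHoo_not_ellp r2 s0 hs (ltW r1).
  by apply; have [] := h _ zmon.
rewrite max_r ?ltW// in hs.
have -> : s = 1 by rewrite -[s]invrK hs -[2^-1]mul1r -splitr invr1.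
split=> [z [uz /= /(ellp_bound _ ltr01)[B hB]]|h].
  apply: (@mem_monHoo_of_l1 _ _ _ _ uz B) => n; apply: le_trans (hB n).
  by apply: ler_sum => k _; rewrite powRr1// normc_ge0.
have t0 : 0 < 1 - r^-1 by rewrite subr_gt0 invf_lt1.
have [b b2 hb] := exists_base_powR_ge t0.
have [z zmon /negP] := exists_monHoo_not_l1 r1 b2 hb (ltW r1).
by apply; have [] := h _ zmon.
Qed.
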